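(* Fix an integer $n\ge2$, and for each integer $N\ge n$ let $v_1=v_1(N)$ be the value of Game 1 with parameters $n$ and $N$. Then, as a function of $N$, $v_1(N)=\Theta\left(\frac{1}{\log^{n-2}(N)}\right)$; that is, there exist constants $c,C>0$ and $N_0$ (depending only on $n$) such that $\frac{c}{\log^{n-2}(N)}\le v_1(N)\le\frac{C}{\log^{n-2}(N)}$ for all $N\ge N_0$.
   Context: $\log$ is the base-2 logarithm and $\log^{k}$ denotes its $k$-fold iterate (not a power), with $\log^0(N)=N$. Game 1 with parameters $n,N$ is the following two-player zero-sum game between Dealer and Gambler. Dealer chooses natural numbers $1\le x_1<\dots<x_n\le N$. A number $i_0$ is chosen uniformly at random from $\{1,\dots,n\}$ (independently of Dealer's choice). Gambler learns the $(n-1)$-tuple $x_{-i_0}=(x_1,\dots,x_{i_0-1},x_{i_0+1},\dots,x_n)$ (but not $i_0$). Gambler then chooses two (distinct) numbers $i,j\in\{1,\dots,n\}$. If $i=i_0$ Gambler wins 1 dollar from Dealer; if $j=i_0$ he loses 1 dollar to Dealer; otherwise no money is transferred. Both players may use mixed strategies, and the value $v_1$ is the minimax value of Gambler's expected winnings: Dealer has a distribution on $(x_1,\dots,x_n)$ such that no Gambler strategy earns more than $v_1$ in expectation, and Gambler has a randomised strategy that earns at least $v_1$ in expectation whatever numbers Dealer chooses. *)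

(* Defs.v *)
From HB Require Import structures.
From mathcomp Require Import all_boot all_order all_algebra.
From mathcomp Require Import lra ring.
From mathcomp Require Import boolp classical_sets reals exp.

Set Implicit Arguments.
Unset Strict Implicit.
Unset Printing Implicit Defensive.

Import Order.TTheory GRing.Theory Num.Theory.
Local Open Scope ring_scope.

Section FiniteZeroSumGames.
Variable R : realType.

Definition is_mixed (T : finType) (p : T -> R) : Prop :=
  (forall t, 0 <= p t) /\ \sum_t p t = 1.

Definition expected_payoff (I J : finType) (A : I -> J -> R)
    (p : I -> R) (q : J -> R) : R :=
  \sum_i \sum_j p i * q j * A i j.

(* A i j is the amount which the row player pays to the column player. *)
Definition is_game_value (I J : finType) (A : I -> J -> R) (v : R) : Prop :=
  (exists2 p : I -> R, is_mixed p &
     forall q : J -> R, is_mixed q -> expected_payoff A p q <= v) /\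
  (exists2 q : J -> R, is_mixed q &
     forall p : I -> R, is_mixed p -> v <= expected_payoff A p q).

(* The default value 0 is irrelevant: a value exists as soon as both players
   have a pure strategy (is_game_value_exists), and it is unique
   (is_game_value_unique). *)
Definition game_value (I J : finType) (A : I -> J -> R) : R :=
  xget 0 [set v | is_game_value A v]%classic.

Lemma is_game_value_unique (I J : finType) (A : I -> J -> R) (v w : R) :
  is_game_value A v -> is_game_value A w -> v = w.
Proof.
move=> [[p hp pv] [q hq qv]] [[p' hp' pw] [q' hq' qw]].
apply/eqP; rewrite eq_le; apply/andP; split.
  exact: le_trans (qv _ hp') (pw _ hq).
exact: le_trans (qw _ hp) (pv _ hq').
Qed.

Let dot (T : finType) (a p : {ffun T -> R}) : R := \sum_t a t * p t.
Let comb (T : finType) (x : R) (p : {ffun T -> R}) (y : R) (q : {ffun T -> R})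
  : {ffun T -> R} := [ffun t => x * p t + y * q t].

Let dot_combr (T : finType) (a p q : {ffun T -> R}) x y :
  dot a (comb x p y q) = x * dot a p + y * dot a q.
Proof.
rewrite /dot !mulr_sumr -big_split /=; apply: eq_bigr => t _.
by rewrite ffunE; ring.
Qed.

Let dot_combl (T : finType) (a p q : {ffun T -> R}) x y :
  dot (comb x p y q) a = x * dot p a + y * dot q a.
Proof.
rewrite /dot !mulr_sumr -big_split /=; apply: eq_bigr => t _.
by rewrite ffunE; ring.
Qed.

Let small_eps (T : eqType) (s : seq T) (f g : T -> R) :
  {in s, forall x, 0 < g x} ->
  exists2 e : R, 0 < e & {in s, forall x, e * f x < g x}.
Proof.
elim: s => [|x s IH] H; first by exists 1.
have [y ys|e e0 he] := IH; first by apply: H; rewrite inE ys orbT.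
have gx : 0 < g x by apply: H; rewrite inE eqxx.
have [d d0 hd] : exists2 d : R, 0 < d & d * f x < g x.
  have hf : 0 < 1 + `|f x| by apply: ltr_pwDl.
  exists (g x / (1 + `|f x|)); first exact: divr_gt0.
  rewrite mulrAC ltr_pdivrMr //; have := ler_norm (f x); nra.
exists (Num.min d e); first by rewrite lt_min d0.
move=> y; rewrite inE => /orP[/eqP->|/[dup] ys /he hy].
  have : Num.min d e <= d by rewrite ge_min lexx.
  have : 0 < Num.min d e by rewrite lt_min d0.
  by nra.
have gy : 0 < g y by apply: H; rewrite inE ys orbT.
have : Num.min d e <= e by rewrite ge_min lexx orbT.
have : 0 < Num.min d e by rewrite lt_min d0.
by nra.
Qed.

Let shift_exists (T : eqType) (s1 s2 : seq T) (a b : T -> R) :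
  {in s1, forall u, 0 <= a u} -> {in s2, forall v, a v < 0} ->
  {in s1, forall u, b u < 0} ->
  {in s1 & s2, forall u v, a u * b v - a v * b u < 0} ->
  exists2 t : R, 0 <= t & {in s1 ++ s2, forall u, b u + t * a u < 0}.
Proof.
move=> a1 a2 b1 h.
have [l l0 [l1 l2]] : exists2 l : R, 0 <= l &
    {in s1, forall u, b u + l * a u < 0} /\
    {in s2, forall v, b v + l * a v <= 0}.
  elim: s2 a2 h => [|v s IH] a2 h.
    by exists 0 => //; split=> // u us; rewrite mul0r addr0 b1.
  have av : a v < 0 by apply: a2; rewrite inE eqxx.
  have [w ws|u w us ws|l l0 [l1 l2]] := IH.
  - by apply: a2; rewrite inE ws orbT.
  - by apply: h => //; rewrite inE ws orbT.
  have [hv|hv] := lerP (b v + l * a v) 0.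
    by exists l => //; split=> // w; rewrite inE => /orP[/eqP->|/l2].
  pose k := b v / - a v.
  have kE : k * a v = - b v by rewrite /k; field; rewrite lt_eqF.
  have lk : l < k by nra.
  exists k; first by apply: le_trans l0 _; apply: ltW.
  split=> [u us|w].
    have := h u v us; rewrite inE eqxx => /(_ isT).
    have -> : b v = - (k * a v) by rewrite kE opprK.
    by nra.
  rewrite inE => /orP[/eqP->|ws]; first by rewrite kE subrr.
  have := l2 _ ws; have : a w < 0 by apply: a2; rewrite inE ws orbT.
  by nra.
have [u us|e e0 he] := @small_eps T s1 a (fun u => - (b u + l * a u)).
  by rewrite oppr_gt0; exact: l1.
exists (l + e) => [|u]; first by rewrite addr_ge0 // ltW.
rewrite mem_cat => /orP[/he|us]; first by rewrite mulrDl; lra.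
have := l2 _ us; have := a2 _ us; nra.
Qed.

Let alternative (T : finType) (D : {ffun T -> R} -> Prop)
    (L S : seq {ffun T -> R}) (C : {ffun T -> R} -> Prop) :
  (exists2 b, D b & forall p, dot b p = 0) ->
  {in L, forall a, D a} ->
  (forall a b t, D a -> D b -> 0 <= t -> D (comb 1 b t a)) ->
  {in S, forall p, C p} ->
  (forall p q x y, C p -> C q -> 0 <= x -> 0 < y -> C (comb x p y q)) ->
  (exists2 p, C p & {in L, forall a, 0 <= dot a p}) \/
  (exists2 b, D b & {in S, forall p, dot b p < 0}).
Proof.
move=> D0 DL Dc; elim: L DL S C => [|a L IH] DL S C CS Cc.
  case: S CS => [|p S] CS; last first.
    by left; exists p => //; apply: CS; rewrite inE eqxx.
  by right; case: D0 => b Db _; exists b.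
have Da : D a by apply: DL; rewrite inE eqxx.
pose S1 := [seq s <- S | 0 <= dot a s].
pose S2 := [seq s <- S | dot a s < 0].
pose C' p := C p /\ 0 <= dot a p.
pose S' := S1 ++ [seq comb (dot a u) v (- dot a v) u | u <- S1, v <- S2].
have [|p|p q x y [Cp ap] [Cq aq] x0 y0|[p [Cp ap] hp]|[b Db hb]] :=
    IH _ S' C'.
- by move=> b bL; apply: DL; rewrite inE bL orbT.
- rewrite mem_cat => /orP[|/allpairsP[[u v] /= [+ + ->]]].
    by rewrite mem_filter => /andP[ap /CS].
  rewrite !mem_filter => /andP[au uS] /andP[av vS]; split.
    by apply: Cc; rewrite ?oppr_gt0 //; apply: CS.
  by rewrite dot_combr; lra.
- split; first exact: Cc.
  by rewrite dot_combr addr_ge0 // mulr_ge0 // ltW.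
- left; exists p => // b; rewrite inE => /orP[/eqP->//|]; exact: hp.
right.
have [u|v|u us|u v us vs|t t0 ht] := @shift_exists _ S1 S2 (dot a) (dot b).
- by rewrite mem_filter => /andP[].
- by rewrite mem_filter => /andP[].
- by apply: hb; rewrite mem_cat us.
- have : comb (dot a u) v (- dot a v) u \in S'.
    by rewrite mem_cat; apply/orP; right; apply: allpairs_f.
  by move/hb; rewrite dot_combr mulNr.
exists (comb 1 b t a); first exact: Dc.
move=> s sS; rewrite dot_combl mul1r; apply: ht.
by rewrite mem_cat !mem_filter sS !andbT; case: lerP.
Qed.

Let skew_solution (T : finType) (t0 : T) (K : T -> T -> R) :
  (forall s t, K s t = - K t s) ->
  exists2 z : T -> R, is_mixed z & forall s, 0 <= \sum_t K s t * z t.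
Proof.
move=> skew.
pose row s : {ffun T -> R} := [ffun t => K s t].
pose delta s : {ffun T -> R} := [ffun t => (t == s)%:R].
pose C (p : {ffun T -> R}) := (forall t, 0 <= p t) /\ 0 < \sum_t p t.
pose D (b : {ffun T -> R}) := exists2 y : T -> R, (forall s, 0 <= y s) &
  forall t, b t = \sum_s y s * K s t.
have dotd b s : dot b (delta s) = b s.
  rewrite /dot (bigD1 s) //= ffunE eqxx mulr1 big1 ?addr0 // => t /negPf ts.
  by rewrite ffunE ts mulr0.
have [||||||] := @alternative T D [seq row s | s <- enum T]
    [seq delta s | s <- enum T] C.
- exists [ffun => 0]; last by move=> p; apply: big1 => t _; rewrite ffunE mul0r.
  by exists (fun=> 0) => // t; rewrite ffunE big1 // => s _; rewrite mul0r.
- move=> _ /mapP[s _ ->]; exists (fun t => (t == s)%:R) => [t|t].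
    exact: ler0n.
  rewrite ffunE (bigD1 s) //= eqxx mul1r big1 ?addr0 // => u /negPf->.
  by rewrite mul0r.
- move=> a b t [y y0 hy] [z z0 hz] h; exists (fun s => z s + t * y s).
    by move=> s; rewrite addr_ge0 // mulr_ge0.
  move=> s; rewrite ffunE hy hz mul1r mulr_sumr -big_split /=.
  by apply: eq_bigr => u _; ring.
- move=> _ /mapP[s _ ->]; split=> [t|]; first by rewrite ffunE ler0n.
  rewrite (bigD1 s) //= ffunE eqxx big1 ?addr0 // => u /negPf us.
  by rewrite ffunE us.
- move=> p q x y [p0 ps] [q0 qs] x0 y0; split=> [t|].
    by rewrite ffunE addr_ge0 // mulr_ge0 // ltW.
  under eq_bigr do rewrite ffunE.
  rewrite big_split /= -!mulr_sumr.
  by apply: ltr_wpDl; [apply: mulr_ge0 => //; apply: ltW|apply: mulr_gt0].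
- move=> [p [p0 ps] hp]; set sp := \sum_t p t in ps.
  exists (fun t => p t / sp); first split=> [t|].
  + by rewrite divr_ge0 // ltW.
  + by rewrite -mulr_suml divff // gt_eqF.
  move=> s; under eq_bigr do rewrite mulrA.
  rewrite -mulr_suml divr_ge0 //; last exact: ltW.
  have := hp (row s); rewrite map_f ?mem_enum // => /(_ isT).
  by rewrite /dot; under eq_bigr do rewrite ffunE.
- move=> [b [y y0 hy] hb].
  have bneg t : b t < 0 by rewrite -dotd; apply: hb; rewrite map_f ?mem_enum.
  have q0 : \sum_t b t * y t = 0.
    have qE : \sum_t b t * y t = \sum_t \sum_s y s * K s t * y t.
      by apply: eq_bigr => t _; rewrite hy mulr_suml.
    have : \sum_t b t * y t = - \sum_t b t * y t.
      rewrite {1}qE exchange_big /= qE -sumrN; apply: eq_bigr => t _.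
      rewrite -sumrN; apply: eq_bigr => s _.
      by rewrite (skew t s); ring.
    by lra.
  have yz t : y t = 0.
    have h s : true -> b s * y s <= 0 by move=> _; have := bneg s; have := y0 s; nra.
    have /eqP := q0; rewrite -oppr_eq0 -sumrN psumr_eq0; last first.
      by move=> s _; rewrite oppr_ge0 h.
    move=> /allP /(_ t); rewrite mem_index_enum => /(_ isT) /=.
    by rewrite oppr_eq0 mulf_eq0 lt_eqF //= => /eqP.
  by have := bneg t0; rewrite hy big1 ?ltxx // => s _; rewrite yz mul0r.
Qed.

Lemma is_game_value_exists (I J : finType) (A : I -> J -> R) (i0 : I) (j0 : J) :
  exists v, is_game_value A v.
Proof.
pose c := 1 + \sum_i \sum_j `|A i j|.
pose B i j := A i j + c.
have B1 i j : 1 <= B i j.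
  have : `|A i j| <= \sum_i \sum_j `|A i j|.
    rewrite (bigD1 i) //= (bigD1 j) //= -addrA lerDl addr_ge0 //.
      by apply: sumr_ge0.
    by apply: sumr_ge0 => ? _; apply: sumr_ge0.
  by have := ler_norm (- A i j); rewrite normrN /B /c; lra.
pose K (s t : (I + J) + 'I_1) : R := match s, t with
  | inl (inl i), inl (inr j) => B i j
  | inl (inl i), inr _ => -1
  | inl (inr j), inl (inl i) => - B i j
  | inl (inr j), inr _ => 1
  | inr _, inl (inl i) => 1
  | inr _, inl (inr j) => -1
  | _, _ => 0 end.
have [[[i|j]|u] [[i'|j']|u']|z [z0 zs] hz] := @skew_solution _ (inr ord0) K;
  rewrite /= ?opprK ?oppr0 //.
pose p i := z (inl (inl i)); pose q j := z (inl (inr j)); pose t := z (inr ord0).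
pose P := \sum_i p i; pose Q := \sum_j q j.
have sum1 : P + Q + t = 1 by rewrite -zs !big_sumType /= big_ord1.
have hI i : t <= \sum_j q j * B i j.
  have := hz (inl (inl i)); rewrite !big_sumType /= big_ord1 /=.
  rewrite big1 ?add0r => [|? _]; last by rewrite mul0r.
  by under eq_bigr do rewrite mulrC; rewrite mulN1r subr_ge0.
have hJ j : \sum_i p i * B i j <= t.
  have := hz (inl (inr j)); rewrite !big_sumType /= big_ord1 /=.
  rewrite [X in _ + X + _]big1 ?addr0 => [|? _]; last by rewrite mul0r.
  under eq_bigr do rewrite mulNr mulrC.
  by rewrite sumrN mul1r addrC subr_ge0.
have QP : Q <= P.
  have := hz (inr ord0); rewrite !big_sumType /= big_ord1 /= mul0r addr0.
  under eq_bigr do rewrite mul1r.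
  by under [X in _ + X]eq_bigr do rewrite mulN1r; rewrite sumrN subr_ge0.
have Pt : P <= t.
  apply: le_trans (hJ j0); apply: ler_sum => i _.
  by rewrite ler_peMr ?B1 // z0.
have t0 : 0 < t by lra.
have Q0 : 0 < Q.
  rewrite lt_def sumr_ge0 ?andbT => [|j _]; last exact: z0.
  apply/eqP => Qz; have := hI i0; rewrite big1 ?leNgt ?t0 // => j _.
  have -> : q j = 0 by apply: (psumr_eq0P _ Qz) => // k _; exact: z0.
  by rewrite mul0r.
have PQ : P = Q.
  apply/eqP; rewrite eq_le QP andbT -(ler_pM2l t0).
  apply: (@le_trans _ _ (\sum_i \sum_j p i * q j * B i j)).
    rewrite mulr_sumr; apply: ler_sum => i _.
    under eq_bigr do rewrite -mulrA.
    by rewrite -mulr_sumr mulrC ler_wpM2l ?hI // z0.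
  rewrite exchange_big /= mulr_sumr; apply: ler_sum => j _.
  under eq_bigr do rewrite mulrAC.
  by rewrite -mulr_suml ler_wpM2r ?hJ // z0.
have Qn0 : Q != 0 by rewrite gt_eqF.
exists (t / Q - c); split.
  exists (fun i => p i / Q); first split=> [i|].
  - by rewrite divr_ge0 ?z0 // ltW.
  - by rewrite -mulr_suml -/P PQ divff.
  move=> q' [q'0 q's]; rewrite /expected_payoff exchange_big /=.
  rewrite -[t / Q - c]mul1r -q's mulr_suml; apply: ler_sum => j _.
  have -> : \sum_i p i / Q * q' j * A i j =
            q' j * ((\sum_i p i * B i j) / Q - c).
    have -> : c = \sum_i p i * c / Q.
      by rewrite -!mulr_suml -/P PQ mulrAC divff // mul1r.
    rewrite mulr_suml -sumrB mulr_sumr; apply: eq_bigr => i _.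
    by rewrite /B; field.
  by rewrite ler_wpM2l // lerD2r ler_pM2r ?invr_gt0.
exists (fun j => q j / Q); first split=> [j|].
- by rewrite divr_ge0 ?z0 // ltW.
- by rewrite -mulr_suml divff.
move=> p' [p'0 p's]; rewrite /expected_payoff.
rewrite -[t / Q - c]mul1r -p's mulr_suml; apply: ler_sum => i _.
have -> : \sum_j p' i * (q j / Q) * A i j =
          p' i * ((\sum_j q j * B i j) / Q - c).
  have -> : c = \sum_j q j * c / Q.
    by rewrite -!mulr_suml -/Q mulrAC divff // mul1r.
  rewrite mulr_suml -sumrB mulr_sumr; apply: eq_bigr => j _.
  by rewrite /B; field.
by rewrite ler_wpM2l // lerD2r ler_pM2r ?invr_gt0.
Qed.

Lemma game_valueP (I J : finType) (A : I -> J -> R) (i0 : I) (j0 : J) :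
  is_game_value A (game_value A).
Proof. exact: (xgetPex 0 (is_game_value_exists A i0 j0)). Qed.

End FiniteZeroSumGames.

Section Game1.
Variables (R : realType) (n N : nat).

(* 'I_N.+1 only serves as a finite type containing 1, ..., N; positions
   1, ..., n are numbered from 0. *)
Definition increasing_positive (x : {ffun 'I_n -> 'I_N.+1}) : bool :=
  [forall i : 'I_n, 0 < x i]%N &&
  [forall i : 'I_n, forall j : 'I_n, (i < j)%N ==> (x i < x j)%N].

Definition dealer_move : Type :=
  {x : {ffun 'I_n -> 'I_N.+1} | increasing_positive x}.
HB.instance Definition _ := Finite.on dealer_move.

Definition observation : Type := {ffun 'I_n.-1 -> 'I_N.+1}.
HB.instance Definition _ := Finite.on observation.

Definition hide_coordinate (x : {ffun 'I_n -> 'I_N.+1}) (i0 : 'I_n) :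
  observation := [ffun k => x (lift i0 k)].

Definition chooses_distinct (g : {ffun observation -> 'I_n * 'I_n}) : bool :=
  [forall o, (g o).1 != (g o).2].

(* Pure strategies: the pair (i, j) is a function of what Gambler sees. *)
Definition gambler_strategy : Type :=
  {g : {ffun observation -> 'I_n * 'I_n} | chooses_distinct g}.
HB.instance Definition _ := Finite.on gambler_strategy.

(* Expected winnings of Gambler, i0 being uniform on the n positions. *)
Definition game1_payoff (x : dealer_move) (g : gambler_strategy) : R :=
  n%:R^-1 * \sum_(i0 < n)
    let ij := val g (hide_coordinate (val x) i0) in
    ((ij.1 == i0)%:R - (ij.2 == i0)%:R).

Definition v1 : R := game_value game1_payoff.

Lemma v1P : (2 <= n <= N)%N -> is_game_value game1_payoff v1.
Proof.
move=> /andP[n2 nN].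
have xP : increasing_positive [ffun i : 'I_n => inord i.+1].
  have xE (i : 'I_n) : (inord i.+1 : 'I_N.+1) = i.+1 :> nat.
    by rewrite inordK // ltnS (leq_trans _ nN).
  apply/andP; split; first by apply/forallP => i; rewrite ffunE xE.
  by do 2 apply/forallP => ?; apply/implyP; rewrite !ffunE !xE.
have gP : chooses_distinct [ffun=> (Ordinal (ltnW n2), Ordinal n2)].
  by apply/forallP => o; rewrite ffunE.
exact: (game_valueP game1_payoff (exist increasing_positive _ xP)
                                 (exist chooses_distinct _ gP)).
Qed.

End Game1.

Definition log2 (R : realType) (x : R) : R := ln x / ln 2.

(* Main.v *)
(* Gambler gains only if the n laws of x_{-i} differ, so both bounds are proved by
   stepping between n - 1 numbers up to M and n numbers up to N with M of order
   log N.

   Lower bound. The level of a < b is 1 + their highest differing binary digit.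
   For an increasing x the n - 1 consecutive levels behave under deletion of a
   point as a tuple that loses one entry, as long as they are monotone; then the
   (n - 1)-point bet applied to the levels wins. If they are not monotone, local
   bets on the order of two neighbouring levels already win a constant and lose
   nothing on monotone levels.

   Upper bound. From a nearly deletion-invariant law of z_1 < ... < z_{n-1} take
   x = (a, a + w(z_1), ..., a + w(z_{n-1})) with a uniform and w(t) an independent
   uniform number in [B^t, 2 B^t). Deleting any x_i with i > 1 deletes a z; deleting
   x_1 instead of x_2 translates a and the w(t), t > z_1, by w(z_1), which changes
   the law by O(1 / B). *)
Require Import Defs.
From HB Require Import structures.
From mathcomp Require Import all_boot all_order all_algebra.
From mathcomp Require Import reals exp.
From mathcomp Require Import zify ring lra.

Set Implicit Arguments.
Unset Strict Implicit.
Unset Printing Implicit Defensive.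

Import Order.TTheory GRing.Theory Num.Theory.
Local Open Scope ring_scope.

(** * Levels and Gambler's bets *)

Lemma eq_divn_pow2_exists (a b : nat) : exists d, (a %/ 2 ^ d == b %/ 2 ^ d)%N.
Proof.
exists (maxn a b); rewrite !divn_small //; apply: leq_ltn_trans (ltn_expl _ (ltnSn 1)).
  exact: leq_maxr.
exact: leq_maxl.
Qed.

(* One more than the highest binary digit at which a and b differ. *)
Definition split_level (a b : nat) : nat := ex_minn (eq_divn_pow2_exists a b).

Lemma split_levelP (a b d : nat) :
  (split_level a b <= d)%N = (a %/ 2 ^ d == b %/ 2 ^ d)%N.
Proof.
rewrite /split_level; case: ex_minnP => m /eqP hm mmin.
apply/idP/idP => [md|]; last exact: mmin.
by rewrite -(subnKC md) expnD !divnMA hm.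
Qed.

Lemma split_level_gt0 (a b : nat) : (a < b)%N -> (0 < split_level a b)%N.
Proof. by move=> ab; rewrite ltnNge split_levelP !divn1 neq_ltn ab. Qed.

Lemma split_level_le (a b M : nat) :
  (a < 2 ^ M)%N -> (b < 2 ^ M)%N -> (split_level a b <= M)%N.
Proof. by move=> aM bM; rewrite split_levelP !divn_small. Qed.

(** Dyadic blocks are intervals, so a block containing [a] and [c] contains [b]. *)
Lemma split_level_max (a b c : nat) : (a < b)%N -> (b < c)%N ->
  split_level a c = maxn (split_level a b) (split_level b c).
Proof.
move=> ab bc; apply/eqP; rewrite eqn_leq; apply/andP; split.
  set d := maxn _ _.
  have : (split_level a b <= d)%N by exact: leq_maxl.
  have : (split_level b c <= d)%N by exact: leq_maxr.
  by rewrite !split_levelP => /eqP -> /eqP ->.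
have := split_levelP a c (split_level a c); rewrite leqnn => /esym/eqP.
set d := split_level a c => e; rewrite geq_max !split_levelP.
have := leq_div2r (2 ^ d) (ltnW ab); have := leq_div2r (2 ^ d) (ltnW bc).
by rewrite e => h1 h2; rewrite eq_sym andbb eqn_leq h1 h2.
Qed.

(* At the level just below a common one, a < b < c would need three distinct digits. *)
Lemma split_level_neq (a b c : nat) : (a < b)%N -> (b < c)%N ->
  split_level a b != split_level b c.
Proof.
move=> ab bc; apply/eqP => e.
have := split_level_gt0 ab; case E: (split_level a b) => [|d] // _.
have h1 : (a %/ 2 ^ d < b %/ 2 ^ d)%N.
  by rewrite ltn_neqAle leq_div2r ?(ltnW ab) // andbT -split_levelP E ltnn.
have h2 : (b %/ 2 ^ d < c %/ 2 ^ d)%N.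
  by rewrite ltn_neqAle leq_div2r ?(ltnW bc) // andbT -split_levelP -e E ltnn.
have /eqP : (a %/ 2 ^ d.+1 == b %/ 2 ^ d.+1)%N by rewrite -split_levelP E.
have /eqP : (b %/ 2 ^ d.+1 == c %/ 2 ^ d.+1)%N by rewrite -split_levelP -e E.
rewrite expnSr !divnMA; lia.
Qed.

Definition increasing_upto (n : nat) (x : nat -> nat) : Prop :=
  forall k, (k.+1 < n)%N -> (x k < x k.+1)%N.

Definition levels (y : nat -> nat) (k : nat) : nat := split_level (y k) (y k.+1).

(** [bump i] skips [i]: removing an inner point merges the two levels beside it into their maximum,
    removing an end point drops the end level. *)
Lemma levels_bump (n : nat) (x : nat -> nat) (i k : nat) : increasing_upto n x ->
  (k.+2 < n)%N -> levels (fun j => x (bump i j)) k =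
    if (k.+1 < i)%N then levels x k
    else if k.+1 == i then maxn (levels x k) (levels x k.+1) else levels x k.+1.
Proof.
move=> xi kn; rewrite /levels /bump.
case: (ltngtP k.+1 i) => h.
- by have -> : (i <= k)%N = false by lia.
- by have -> : (i <= k)%N by lia.
- have -> : (i <= k)%N = false by lia.
  by rewrite -split_level_max // xi // ltnW.
Qed.

Lemma levels_neq (n : nat) (x : nat -> nat) (k : nat) : increasing_upto n x ->
  (k.+2 < n)%N -> levels x k != levels x k.+1.
Proof. by move=> xi kn; apply: split_level_neq; apply: xi => //; apply: ltnW. Qed.

Section GamblerBets.
Variable R : realType.
Implicit Types (g : (nat -> nat) -> nat -> R) (x y z : nat -> nat).

(* A bet g y i is the probability of naming i as Gambler's first choice minus
   that of naming it as the second choice, up to a constant factor. *)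
Definition gambler_secures (n N : nat) (c : R) : Prop :=
  exists g : (nat -> nat) -> nat -> R,
  [/\ forall y, \sum_(i < n) g y i = 0,
      forall y i, `|g y i| <= 1,
      forall y y' i, (forall k, (k < n.-1)%N -> y k = y' k) -> g y i = g y' i &
      forall x, increasing_upto n x -> (forall k, (k < n)%N -> (x k <= N)%N) ->
        c <= \sum_(i < n) g (fun k => x (bump i k)) i].

(** The visible number over [N] is bet on index 0 and against index 1, which gains (x_1 - x_0) / N.
    Capping at [N] bounds the bet on arbitrary input. *)
Lemma gambler_secures2 (N : nat) : (0 < N)%N -> gambler_secures 2 N (N%:R^-1).
Proof.
move=> N0; have N0' : 0 < N%:R :> R by rewrite ltr0n.
exists (fun y i => (if i == 0%N then (minn (y 0%N) N)%:R / N%:R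
          else if i == 1%N then - ((minn (y 0%N) N)%:R / N%:R) else 0) : R); split.
- by move=> y; rewrite !big_ord_recl big_ord0 /= addr0 subrr.
- move=> y i; have h : `|(minn (y 0%N) N)%:R / N%:R| <= 1 :> R.
    rewrite ger0_norm ?divr_ge0 // ler_pdivrMr // mul1r ler_nat; exact: geq_minr.
  by case: ifP => // _; case: ifP => _; rewrite ?normrN // normr0.
- by move=> y y' i /(_ 0%N isT) ->.
- move=> x xi xN; rewrite !big_ord_recl big_ord0 /= addr0 /bump /=.
  have h1 := xN 1%N isT; have h0 := xN 0%N isT; have h := xi 0%N isT.
  rewrite (minn_idPl h1) (minn_idPl h0) -mulrBl ler_pdivlMr // mulVf ?gt_eqF //.
  by rewrite -natrB ?(ltnW h) // ler1n subn_gt0.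
Qed.

(** On a visible level l the bets are proportional to -l, 2l, -l. If [x] has levels a and b, the
    gain is proportional to 2 max(a, b) - a - b = |a - b|, at least 1 because the levels differ. *)
Lemma gambler_secures3 (N M : nat) : (0 < M)%N -> (N < 2 ^ M)%N ->
  gambler_secures 3 N ((2 * M%:R)^-1).
Proof.
move=> M0 NM; have M0' : 0 < M%:R :> R by rewrite ltr0n.
pose f (y : nat -> nat) : R := (minn (levels y 0) M)%:R / (2 * M%:R).
have f0 y : 0 <= f y by rewrite divr_ge0 // mulr_ge0.
have f1 y : 2 * f y <= 1.
  rewrite /f mulrA ler_pdivrMr ?mulr_gt0 // mul1r ler_pM2l // ler_nat; exact: geq_minr.
exists (fun y i => if i == 1%N then 2 * f y else if (i < 3)%N then - f y else 0); split.
- by move=> y; rewrite !big_ord_recl big_ord0 /=; ring.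
- move=> y i; have := f0 y; have := f1 y => h1 h2.
  case: ifP => _; first by rewrite ger0_norm //; lra.
  case: ifP => _; last by rewrite normr0.
  by rewrite normrN ger0_norm //; lra.
- by move=> y y' i h; rewrite /f /levels !h.
- move=> x xi xN; rewrite !big_ord_recl big_ord0 /= addr0 /f.
  have := @levels_neq 3 _ 0%N xi isT.
  have [l0 l1] : (levels x 0 <= M)%N /\ (levels x 1 <= M)%N.
    by split; apply: split_level_le; apply: leq_ltn_trans NM; apply: xN.
  rewrite !(levels_bump _ xi) //= => ne.
  set p := maxn _ _; set t := (2 * M%:R)^-1.
  have t0 : 0 <= t by rewrite invr_ge0 mulr_ge0.
  have : (1 + minn (levels x 1) M + minn (levels x 0) M <= 2 * minn p M)%N.
    rewrite /p; lia.
  by rewrite -(ler_nat R) natrM !natrD => /(ler_wpM2l t0); lra.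
Qed.

(* Deleting one of four consecutive points with consecutive levels a, b, c leaves
   two levels: b, c; then max(a, b), c; then a, max(b, c); then a, b. Betting the
   first row when these increase and the second when they decrease pays 0 if
   a, b, c is monotone and at least 1 otherwise. *)
Definition quad_bet (s : bool) (j : nat) : R :=
  nth 0 (if s then [:: 1; -3; 2; 0] else [:: 0; 2; -3; 1]) j.

Lemma norm_quad_bet s j : `|quad_bet s j| <= 3.
Proof.
rewrite /quad_bet; case: s; case: j => [|[|[|[|j]]]] /=;
  rewrite ?normrN ?nth_nil ?normr0 // ger0_norm //; lra.
Qed.

Lemma sum_window (n k : nat) (F : nat -> R) : (k + 3 < n)%N ->
  \sum_(i < n) (if (k <= i)%N then (if (i < k + 4)%N then F i else 0) else 0) =
  F k + F k.+1 + F k.+2 + F k.+3.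
Proof.
move=> kn; rewrite -(big_mkord xpredT (fun i => if (k <= i)%N then
  (if (i < k + 4)%N then F i else 0) else 0)) (big_cat_nat (n := k)) //=; last lia.
rewrite (big_cat_nat (m := k) (n := k + 4)) ?leq_addr //=; last lia.
rewrite [X in X + _]big_nat_cond big1 ?add0r; last first.
  by move=> i; rewrite andbT => /andP[_ h]; rewrite leqNgt h.
rewrite [X in _ + X]big_nat_cond [X in _ + X]big1 ?addr0; last first.
  by move=> i; rewrite andbT => /andP[h _]; rewrite [(i < _)%N]ltnNge h; case: ifP.
have -> : (k + 4)%N = k.+4 by lia.
do 4 (rewrite big_nat_recr /=; last by lia).
rewrite big_geq // add0r.
have -> : (k <= k.+1)%N by lia. have -> : (k <= k.+2)%N by lia.
have -> : (k <= k.+3)%N by lia.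
have -> : (k < k.+4)%N by lia. have -> : (k.+1 < k.+4)%N by lia.
by rewrite leqnn !ltnS leqnSn leqnn.
Qed.

Definition local_bet (k : nat) (y : nat -> nat) (i : nat) : R :=
  if (k <= i)%N then
    (if (i < k + 4)%N then quad_bet (levels y k < levels y k.+1)%N (i - k) else 0)
  else 0.

Lemma local_bet_sum (n k : nat) y : (k + 3 < n)%N -> \sum_(i < n) local_bet k y i = 0.
Proof.
move=> kn; rewrite (@sum_window n k (fun i => quad_bet _ (i - k))) //.
rewrite subnn !subSn ?leqnn ?leqnSn //; try lia.
by rewrite subnn /quad_bet; case: ifP => _ /=; ring.
Qed.

Lemma local_bet_gain (n k : nat) x : (k + 3 < n)%N -> increasing_upto n x ->
  ((levels x k < levels x k.+1) != (levels x k.+1 < levels x k.+2))%N%:R <=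
  \sum_(i < n) local_bet k (fun j => x (bump i j)) i.
Proof.
move=> kn xi.
rewrite (@sum_window n k (fun i => quad_bet (levels (fun j => x (bump i j)) k <
  levels (fun j => x (bump i j)) k.+1)%N (i - k))) //.
rewrite subnn !subSn ?leqnn ?leqnSn //; try lia.
rewrite subnn !(levels_bump _ xi) //; try lia.
have h0 := levels_neq (k := k) xi ltac:(lia).
have h1 := levels_neq (k := k.+1) xi ltac:(lia).
move: h0 h1; set a := levels x k; set b := levels x k.+1; set c := levels x k.+2.
rewrite !ltnS !eqSS.
rewrite !(ltnn, ltnSn, leqnn, leqnSn, eqxx) /=.
have -> : (k.+1 == k) = false by lia.
have -> : (k.+2 == k) = false by lia.
have -> : (k.+2 < k)%N = false by lia.
have -> : (k.+1 < k)%N = false by lia.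
rewrite gtn_max leq_max /quad_bet.
(* Neighbouring levels cannot tie, but [a = c] is possible. *)
case: (ltngtP a b) => // ab _; case: (ltngtP b c) => // bc _;
  case: (ltngtP a c) => ac /=; lra || lia.
Qed.

(** * Bets on a monotone tuple of levels *)

Lemma increasing_uptoP (m : nat) (z : nat -> nat) :
  reflect (increasing_upto m z) (all (fun k => z k < z k.+1)%N (iota 0 m.-1)).
Proof.
apply: (iffP allP) => h k; last by rewrite mem_iota => /andP[_ km]; apply: h; lia.
by move=> km; apply: h; rewrite mem_iota; lia.
Qed.

Definition reversed (m : nat) (z : nat -> nat) (k : nat) : nat := z (m.-1 - k)%N.

Lemma reversed_increasing (m : nat) (z : nat -> nat) :
  increasing_upto m (reversed m z) <-> forall k, (k.+1 < m)%N -> (z k.+1 < z k)%N.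
Proof.
split=> h k km; rewrite /reversed.
  have := h (m.-2 - k)%N ltac:(lia); rewrite /reversed.
  by have [-> ->] : (m.-1 - (m.-2 - k) = k.+1 /\ m.-1 - (m.-2 - k).+1 = k)%N by lia.
have -> : (m.-1 - k = (m.-1 - k.+1).+1)%N by lia.
by apply: h; lia.
Qed.

Lemma increasing_upto_bump (m i : nat) (z : nat -> nat) :
  increasing_upto m.+1 z -> increasing_upto m (fun k => z (bump i k)).
Proof.
move=> zi k km; rewrite /bump.
have h1 := zi k ltac:(lia); have h2 := zi k.+1 ltac:(lia).
by case: (leqP i k) => h; case: (leqP i k.+1) => h'; rewrite ?add1n ?add0n //; lia.
Qed.

(** Two deletions lose the same level, so one point gets no stake. Increasing levels: removing point
    0 or 1 loses level 0, and point [j.+1] takes the bet for level [j]. Decreasing levels: removing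
    either of the last two points loses the last level; the last point gets nothing and the others
    take the bets for the reversed tuple. *)
Definition monotone_bet (g : (nat -> nat) -> nat -> R) (p : nat) (y : nat -> nat)
    (i : nat) : R :=
  let z := levels y in
  if all (fun k => z k < z k.+1)%N (iota 0 p.+1) then
    (if i is j.+1 then g z j else 0)
  else if all (fun k => reversed p.+2 z k < reversed p.+2 z k.+1)%N (iota 0 p.+1) then
    (if (i < p.+3)%N then g (reversed p.+2 z) (p.+2 - i)%N else 0)
  else 0.

Lemma monotone_bet_norm g p y i : (forall z j, `|g z j| <= 1) ->
  `|monotone_bet g p y i| <= 1.
Proof.
move=> g1; rewrite /monotone_bet.
by case: ifP => _; [case: i => [|i]|case: ifP => _; [case: ifP => _|]];
  rewrite ?normr0.
Qed.

Lemma sum_reversed (p : nat) (f : nat -> R) :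
  \sum_(i < p.+3) f (p.+2 - i)%N = \sum_(i < p.+3) f i.
Proof. by rewrite [RHS](reindex_inj rev_ord_inj). Qed.

Lemma monotone_bet_sum g p y : (forall z, \sum_(i < p.+3) g z i = 0) ->
  \sum_(i < p.+4) monotone_bet g p y i = 0.
Proof.
move=> g0; rewrite /monotone_bet; case: (all _ _).
  by rewrite big_ord_recl add0r; apply: g0.
case: (all _ _); last by rewrite big1.
rewrite big_ord_recr /= ltnn addr0.
set z := reversed p.+2 (levels y); rewrite -[RHS](g0 z) -(sum_reversed p (g z)).
by apply: eq_bigr => i _; rewrite ltn_ord.
Qed.

Lemma monotone_bet_local g p y y' i :
  (forall z z' j, (forall k, (k < p.+2)%N -> z k = z' k) -> g z j = g z' j) ->
  (forall k, (k < p.+3)%N -> y k = y' k) ->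
  monotone_bet g p y i = monotone_bet g p y' i.
Proof.
move=> gl yy; rewrite /monotone_bet.
have lE k : (k < p.+2)%N -> levels y k = levels y' k.
  by move=> kp; rewrite /levels !yy //; lia.
have rE k : (k < p.+2)%N -> reversed p.+2 (levels y) k = reversed p.+2 (levels y') k.
  by move=> kp; rewrite /reversed lE //; lia.
have E (z z' : nat -> nat) : (forall k, (k < p.+2)%N -> z k = z' k) ->
    all (fun k => z k < z k.+1)%N (iota 0 p.+1) =
    all (fun k => z' k < z' k.+1)%N (iota 0 p.+1).
  by move=> zz; apply: eq_in_all => k; rewrite mem_iota => kp; rewrite !zz //; lia.
rewrite (E _ _ lE) (E _ _ rE); case: ifP => _; first by case: i => // i; exact: gl.
by case: ifP => // _; case: ifP => // _; exact: gl.
Qed.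

(** A merged pair keeps its later level, so the level before point [i] is lost; [i.-1] also covers
    [i = 0]. *)
Lemma levels_increasing_bump (p : nat) (x : nat -> nat) (i k : nat) :
  increasing_upto p.+4 x -> increasing_upto p.+3 (levels x) -> (k < p.+2)%N ->
  levels (fun j => x (bump i j)) k = levels x (bump i.-1 k).
Proof.
move=> xi li kp; rewrite (levels_bump _ xi) //; have := li k ltac:(lia).
rewrite /bump; case: (ltngtP k.+1 i) => h l.
- by rewrite (_ : (i.-1 <= k)%N = false) //; lia.
- by rewrite (_ : (i.-1 <= k)%N = true) //; lia.
- by rewrite (_ : (i.-1 <= k)%N = true) ?add1n //; lia.
Qed.

(** A merged pair keeps its earlier level, so the level after point [i] is lost; [minn] covers the
    last point, which has none after it. *)
Lemma levels_decreasing_bump (p : nat) (x : nat -> nat) (i k : nat) :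
  increasing_upto p.+4 x -> increasing_upto p.+3 (reversed p.+3 (levels x)) ->
  (k < p.+2)%N -> levels (fun j => x (bump i j)) k = levels x (bump (minn i p.+2) k).
Proof.
move=> xi /reversed_increasing li kp; rewrite (levels_bump _ xi) //.
have := li k ltac:(lia); rewrite /bump; case: (ltngtP k.+1 i) => h l.
- by rewrite (_ : (minn i p.+2 <= k)%N = false) //; lia.
- by rewrite (_ : (minn i p.+2 <= k)%N = true) //; lia.
- by rewrite (_ : (minn i p.+2 <= k)%N = false) ?add0n //; lia.
Qed.

Lemma monotone_bet_increasing g p x :
  (forall z z' j, (forall k, (k < p.+2)%N -> z k = z' k) -> g z j = g z' j) ->
  increasing_upto p.+4 x -> increasing_upto p.+3 (levels x) ->
  \sum_(i < p.+4) monotone_bet g p (fun k => x (bump i k)) i =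
  \sum_(i < p.+3) g (fun k => levels x (bump i k)) i.
Proof.
move=> gl xi li.
have H i : all (fun k => levels (fun j => x (bump i j)) k <
    levels (fun j => x (bump i j)) k.+1)%N (iota 0 p.+1).
  apply/(increasing_uptoP p.+2) => k kp.
  rewrite !(levels_increasing_bump _ xi) //; last lia.
  exact: increasing_upto_bump li _ _.
rewrite big_ord_recl {1}/monotone_bet H add0r; apply: eq_bigr => i _.
rewrite /monotone_bet H lift0; apply: gl => k kp.
by rewrite (levels_increasing_bump _ xi).
Qed.

Lemma monotone_bet_decreasing g p x :
  (forall z z' j, (forall k, (k < p.+2)%N -> z k = z' k) -> g z j = g z' j) ->
  increasing_upto p.+4 x -> increasing_upto p.+3 (reversed p.+3 (levels x)) ->
  \sum_(i < p.+4) monotone_bet g p (fun k => x (bump i k)) i =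
  \sum_(i < p.+3) g (fun k => reversed p.+3 (levels x) (bump i k)) i.
Proof.
move=> gl xi li.
have rE i k : (k < p.+2)%N -> reversed p.+2 (levels (fun j => x (bump i j))) k =
    reversed p.+3 (levels x) (bump (p.+2 - minn i p.+2) k).
  move=> kp; rewrite {1}/reversed (levels_decreasing_bump _ xi) //; last lia.
  by rewrite /reversed /bump; congr (levels x _); lia.
have H i : increasing_upto p.+2 (reversed p.+2 (levels (fun j => x (bump i j)))).
  move=> k kp; rewrite !rE //; last lia.
  exact: increasing_upto_bump li _ _.
(* The first test fails on a decreasing tuple with at least two visible levels, hence the four
   points. *)
have H' i : all (fun k => levels (fun j => x (bump i j)) k <
    levels (fun j => x (bump i j)) k.+1)%N (iota 0 p.+1) = false.
  apply/negP => /(increasing_uptoP p.+2) /(_ 0%N isT).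
  have /reversed_increasing /(_ 0%N isT) := H i; lia.
rewrite big_ord_recr /= [X in _ + X]/monotone_bet H' ltnn if_same addr0.
rewrite -(sum_reversed p (fun i => g (fun k => reversed p.+3 (levels x) (bump i k)) i)).
apply: eq_bigr => i _; rewrite /monotone_bet H'.
rewrite (introT (increasing_uptoP p.+2 _) (H i) :
  all (fun k => _ < _)%N (iota 0 p.+1) = true).
rewrite (_ : (_ < p.+3)%N = true); last exact: ltn_ord.
by apply: gl => k kp; rewrite rE // (minn_idPl _) // -ltnS.
Qed.

(** The local bets are joined to the monotone bet with a small weight [a]. On non-monotone levels
    the former win at least 1 and the latter loses at most 1/2; on monotone levels the former lose
    nothing and the latter wins at least [a * c]. *)
Lemma gambler_secures_step (p N M : nat) (c : R) : 0 <= c <= 1 -> (N < 2 ^ M)%N ->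
  gambler_secures p.+3 M c ->
  gambler_secures p.+4 N (c / (2 * p.+4%:R * (3 * p.+1%:R + 1))).
Proof.
move=> /andP[c0 c1] NM [g [g0 g1 gl gc]].
(* [K] bounds the combined bet: 3 for each of the [p.+1] local bets and 1 for the rest. [a] gives
   the worst monotone loss, [p.+4], the weight 1/2. *)
pose K : R := 3 * p.+1%:R + 1; pose a : R := (2 * p.+4%:R)^-1.
have p4 : 1 <= p.+4%:R :> R by rewrite ler1n.
have K1 : 1 <= K by rewrite /K lerDr mulr_ge0.
have a0 : 0 < a by rewrite invr_gt0 mulr_gt0 ?ltr0n.
have ap : a * p.+4%:R = 1 / 2 by rewrite /a invfM -mulrA mulVf ?pnatr_eq0 // mulr1 div1r.
have a1 : a <= 1 / 2 by rewrite -ap ler_peMr // ltW.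
have -> : c / (2 * p.+4%:R * (3 * p.+1%:R + 1)) = a * c / K.
  by rewrite invfM mulrA [c * _]mulrC.
exists (fun y i => (\sum_(k < p.+1) local_bet k y i + a * monotone_bet g p y i) / K).
have kl (k : 'I_p.+1) : (k + 3 < p.+4)%N by have := ltn_ord k; lia.
split.
- move=> y; rewrite -mulr_suml big_split exchange_big /= -mulr_sumr.
  rewrite (monotone_bet_sum _ g0) mulr0 addr0 big1 ?mul0r // => k _.
  exact: local_bet_sum.
- move=> y i; rewrite normrM normfV (ger0_norm (x := K)) ?ler_pdivrMr ?mul1r; try lra.
  apply: le_trans (ler_normD _ _) _; apply: lerD.
    apply: le_trans (ler_norm_sum _ _ _) _.
    apply: (@le_trans _ _ (\sum_(k < p.+1) 3)); last by rewrite sumr_const card_ord mulr_natr.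
    apply: ler_sum => k _; rewrite /local_bet; case: ifP => _; last by rewrite normr0.
    by case: ifP => _; rewrite ?normr0 ?norm_quad_bet.
  have := monotone_bet_norm p y i g1; rewrite normrM (gtr0_norm a0); nra.
- move=> y y' i yy; congr ((_ + a * _) / K); last exact: monotone_bet_local.
  apply: eq_bigr => k _; rewrite /local_bet /levels !yy //; have := ltn_ord k; lia.
move=> x xi xN; rewrite -mulr_suml ler_pM2r ?invr_gt0; last lra.
rewrite big_split exchange_big /= -mulr_sumr.
set S := \sum_(k < _) _; set T := \sum_(i < _) _.
have SE : \sum_(k < p.+1) ((levels x k < levels x k.+1) !=
    (levels x k.+1 < levels x k.+2))%N%:R <= S.
  by apply: ler_sum => k _; exact: local_bet_gain.
have S0 : 0 <= S by apply: le_trans SE; apply: sumr_ge0.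
have lM k : (k < p.+3)%N -> (levels x k <= M)%N.
  move=> kp; apply: split_level_le; apply: leq_ltn_trans NM; apply: xN => //.
  exact: ltnW.
have mono : c <= T -> a * c <= S + a * T by nra.
have [/existsP[k kP]|/existsPn H] := boolP [exists k : 'I_p.+1,
    ((levels x k < levels x k.+1) != (levels x k.+1 < levels x k.+2))%N].
  have S1 : 1 <= S.
    apply: le_trans SE; rewrite (bigD1 k) //= kP lerDl; exact: sumr_ge0.
  have T1 : - p.+4%:R <= T.
    have : `|T| <= \sum_(i < p.+4) 1.
      apply: le_trans (ler_norm_sum _ _ _) _; apply: ler_sum => i _.
      exact: monotone_bet_norm.
    by rewrite sumr_const card_ord ler_norml => /andP[].
  have := ler_wpM2l (ltW a0) T1; rewrite mulrN ap.
  by have := ler_wpM2l (ltW a0) c1; lra.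
(* Successive comparisons agree, so all have the direction of the first. *)
have E k : (k < p.+2)%N -> (levels x k < levels x k.+1)%N = (levels x 0 < levels x 1)%N.
  elim: k => [//|k IH] kp; rewrite -IH; last exact: ltnW.
  by have := H (Ordinal (kp : (k < p.+1)%N)); rewrite negbK => /eqP.
apply: mono => //; have [l|l] := ltnP (levels x 0) (levels x 1).
  have li : increasing_upto p.+3 (levels x) by move=> k kp; rewrite E.
  by rewrite /T monotone_bet_increasing //; apply: gc.
have li : increasing_upto p.+3 (reversed p.+3 (levels x)).
  apply/reversed_increasing => k kp.
  have := levels_neq xi kp; have := E k kp; rewrite [RHS]ltnNge l /=; lia.
rewrite /T monotone_bet_decreasing //; apply: gc => // k kp.
by rewrite /reversed lM //; lia.
Qed.

End GamblerBets.

(** * From bets and laws to the value of the game *)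

Definition extend (m : nat) (f : 'I_m -> nat) (k : nat) : nat :=
  if insub k is Some j then f j else 0%N.

Lemma extendE (m : nat) (f : 'I_m -> nat) (j : 'I_m) : extend f j = f j.
Proof. by rewrite /extend valK. Qed.

Definition seen (n N : nat) (o : observation n N) : nat -> nat :=
  extend (fun k => (o : {ffun 'I_n.-1 -> 'I_N.+1}) k).

Section ValueBounds.
Variable R : realType.

Lemma pure_is_mixed (T : finType) (t : T) : is_mixed (fun s => (s == t)%:R : R).
Proof.
split=> [s|]; first exact: ler0n.
by rewrite (bigD1 t) //= eqxx big1 ?addr0 // => s /negPf ->.
Qed.

(** Regroups the expectation by observation: the inner sum is the joint weight of seeing [o] with
    hidden index [i]. *)
Lemma hide_disintegration (n N : nat) (p : dealer_move n N -> R)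
    (phi : observation n N -> 'I_n -> R) :
  \sum_x p x * \sum_i phi (hide_coordinate (val x) i) i =
  \sum_o \sum_i (\sum_x p x * (hide_coordinate (val x) i == o)%:R) * phi o i.
Proof.
under eq_bigr do rewrite mulr_sumr.
under [RHS]eq_bigr do under eq_bigr do rewrite mulr_suml.
under [RHS]eq_bigr do rewrite exchange_big /=.
rewrite [RHS]exchange_big /=; apply: eq_bigr => x _.
rewrite [RHS]exchange_big /=; apply: eq_bigr => i _.
rewrite (bigD1 (hide_coordinate (val x) i)) //= eqxx mulr1 big1 ?addr0 // => o.
by rewrite eq_sym => /negPf ->; rewrite mulr0 mul0r.
Qed.

Lemma sum_indicator (n : nat) (W : 'I_n -> R) (a b : 'I_n) :
  \sum_i W i * ((a == i)%:R - (b == i)%:R) = W a - W b.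
Proof.
have E c : \sum_i W i * (c == i)%:R = W c.
  rewrite (bigD1 c) //= eqxx mulr1 big1 ?addr0 // => i.
  by rewrite eq_sym => /negPf ->; rewrite mulr0.
by under eq_bigr do rewrite mulrBr; rewrite sumrB !E.
Qed.

(** Gambler answers Dealer's optimal [p] with a best pure response: after seeing [o] he bets on the
    heaviest index and against the lightest. As [h] sums to 0 and is bounded by 1, it earns at most
    [n] times the difference of these weights; the other factor [n] comes from the uniform hidden
    index. *)
Lemma le_v1 (n N : nat) (c : R) : (2 <= n <= N)%N ->
  gambler_secures n N c -> c / n%:R ^+ 2 <= v1 R n N.
Proof.
move=> nN; have /andP[n2 _] := nN; have n0 : 0 < n%:R :> R by rewrite ltr0n ltnW.
move=> [h [h0 h1 hl hc]]; have [[p [p0 p1] pv] _] := v1P R nN.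
pose W i o := \sum_x p x * (hide_coordinate (val x) i == o)%:R.
pose ij0 := (Ordinal (ltnW n2), Ordinal n2).
pose best o := [arg max_(ij > ij0 | ij.1 != ij.2) (W ij.1 o - W ij.2 o)]%O.
have bestP o : (best o).1 != (best o).2 /\ forall i j, W i o - W j o <=
    W (best o).1 o - W (best o).2 o.
  rewrite /best; case: arg_maxP => // -[a b] /= ab mx; split=> // i j.
  (* For [i = j] the maximum must be nonnegative, which follows from comparing with the swapped
     pair. *)
  have [<-|ne] := eqVneq i j; last exact: (mx (i, j)).
  have := mx (a, b) ab; have := mx (b, a); rewrite eq_sym => /(_ ab) /=; lra.
have gP : chooses_distinct [ffun o => best o].
  by apply/forallP => o; rewrite ffunE; case: (bestP o).
pose g : gambler_strategy n N := exist (@chooses_distinct n N) _ gP.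
have := pv _ (pure_is_mixed g); rewrite /expected_payoff.
under eq_bigr => x _.
  rewrite (bigD1 g) //= eqxx mulr1 big1 ?addr0; last first.
    by move=> k /negPf ->; rewrite mulr0 mul0r.
  rewrite /game1_payoff mulrCA; over.
rewrite -mulr_sumr.
under eq_bigr do under eq_bigr do rewrite ffunE.
rewrite (hide_disintegration p (fun o i => ((best o).1 == i)%:R - ((best o).2 == i)%:R)).
under eq_bigr do rewrite (sum_indicator (fun i => W i _)).
rewrite mulrC ler_pdivrMr // => le_v.
rewrite ler_pdivrMr ?exprn_gt0 // expr2 mulrA.
apply: (@le_trans _ _ (\sum_(x : dealer_move n N) p x *
  \sum_(i < n) h (seen (hide_coordinate (val x) i)) i)).
  rewrite -[c]mul1r -p1 mulr_suml; apply: ler_sum => x _; apply: ler_wpM2l => //.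
  pose X := extend (fun i => val x i : nat).
  have /andP[_ /forallP xi] := valP x.
  have -> : \sum_i h (seen (hide_coordinate (val x) i)) i =
            \sum_(i < n) h (fun k => X (bump i k)) i.
    apply: eq_bigr => i _; apply: hl => k kn.
    rewrite /seen (extendE _ (Ordinal kn)) ffunE.
    by rewrite -[bump i k]/(nat_of_ord (lift i (Ordinal kn))) /X extendE.
  apply: hc => k kn.
    rewrite /X (extendE _ (Ordinal kn)) (extendE _ (Ordinal (ltnW kn))).
    by have /forallP /(_ (Ordinal kn)) := xi (Ordinal (ltnW kn)); rewrite /= leqnn.
  by rewrite /X (extendE _ (Ordinal kn)) -ltnS.
rewrite (hide_disintegration p (fun o i => h (seen o) i)).
apply: le_trans (ler_wpM2r (ltW n0) le_v); rewrite mulr_suml.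
apply: ler_sum => o _; have [_ bo] := bestP o; set D := W _ o - W _ o in bo *.
(* Subtracting the lightest weight is free because [h] sums to 0. *)
have -> : \sum_i (\sum_x p x * (hide_coordinate (val x) i == o)%:R) * h (seen o) i =
    \sum_i (W i o - W (best o).2 o) * h (seen o) i.
  under [RHS]eq_bigr do rewrite mulrBl.
  by rewrite sumrB -mulr_sumr h0 mulr0 subr0.
apply: (@le_trans _ _ (\sum_(i < n) D)); last by rewrite sumr_const card_ord mulr_natr.
apply: ler_sum => i _; apply: le_trans (ler_norm _) _; rewrite normrM.
have D0 : `|W i o - W (best o).2 o| <= D.
  by rewrite ler_norml bo andbT lerNl opprB bo.
by rewrite -[D]mulr1; apply: ler_pM.
Qed.

(* The uniform law on Omega is the mixed strategy; F ranges over the bounded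
   test functions of the observed n - 1 coordinates. *)
Definition dealer_secures (n N : nat) (e : R) : Prop :=
  exists (Omega : finType) (w0 : Omega) (X : Omega -> nat -> nat),
  [/\ forall w, increasing_upto n (X w),
      forall w k, (k < n)%N -> (0 < X w k <= N)%N &
      forall F : (nat -> nat) -> R, (forall y, `|F y| <= 1) ->
        (forall y y', (forall k, (k < n.-1)%N -> y k = y' k) -> F y = F y') ->
        forall i, (i < n)%N ->
        \sum_w F (fun k => X w (bump i k)) <=
        \sum_w F (fun k => X w (bump 0 k)) + e * #|Omega|%:R].

(** Dealer plays the law of [X] against Gambler's optimal mixture. For a fixed pure strategy each
    hidden index may be replaced by 0 at cost [e]; what is seen no longer depends on the index, and
    the two choices cancel. *)
Lemma v1_le (n N : nat) (e : R) : (2 <= n <= N)%N ->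
  dealer_secures n N e -> v1 R n N <= e.
Proof.
move=> nN; have /andP[n2 _] := nN; have n0 : 0 < n%:R :> R by rewrite ltr0n ltnW.
move=> [Omega [w0 [X [Xi XN XF]]]]; have [_ [q [q0 q1] vq]] := v1P R nN.
have cardO : 0 < #|Omega|%:R :> R by rewrite ltr0n; apply/card_gt0P; exists w0.
have fP w : increasing_positive [ffun i : 'I_n => inord (X w i) : 'I_N.+1].
  have XE (i : 'I_n) : (inord (X w i) : 'I_N.+1) = X w i :> nat.
    by rewrite inordK // ltnS; case/andP: (XN w i (ltn_ord i)).
  have mono (i j : nat) : (i < j)%N -> (j < n)%N -> (X w i < X w j)%N.
    elim: j => // j IH; rewrite ltnS leq_eqVlt => /orP[/eqP ->|ij] jn.
      exact: Xi.
    by apply: ltn_trans (IH ij (ltnW jn)) _; apply: Xi.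
  apply/andP; split; first apply/forallP => i.
    by rewrite ffunE XE; case/andP: (XN w i (ltn_ord i)).
  apply/forallP => i; apply/forallP => j; apply/implyP => ij.
  by rewrite !ffunE !XE mono.
pose f w : dealer_move n N := exist (@increasing_positive n N) _ (fP w).
pose p t := (\sum_w (f w == t)%:R) / #|Omega|%:R : R.
have push (phi : dealer_move n N -> R) :
    \sum_t p t * phi t = (\sum_w phi (f w)) / #|Omega|%:R.
  rewrite /p; under eq_bigr do rewrite mulrAC mulr_suml.
  rewrite -mulr_suml exchange_big /=; congr (_ / _); apply: eq_bigr => w _.
  rewrite (bigD1 (f w)) //= eqxx mul1r big1 ?addr0 // => t.
  by rewrite eq_sym => /negPf ->; rewrite mul0r.
have pm : is_mixed p.
  split=> [t|]; first by rewrite divr_ge0 // sumr_ge0.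
  under eq_bigr do rewrite -[p _]mulr1.
  by rewrite (push (fun=> 1)) sumr_const divff // gt_eqF.
apply: le_trans (vq _ pm) _; rewrite /expected_payoff exchange_big /=.
rewrite -[e]mul1r -q1 mulr_suml; apply: ler_sum => g _.
under eq_bigr do rewrite mulrAC mulrC.
rewrite -mulr_sumr; apply: ler_wpM2l => //; rewrite push.
rewrite ler_pdivrMr // /game1_payoff -mulr_sumr mulrC ler_pdivrMr //.
pose phi (o : observation n N) (i : 'I_n) : R :=
  ((val g o).1 == i)%:R - ((val g o).2 == i)%:R.
pose ob (y : nat -> nat) : observation n N := [ffun k : 'I_n.-1 => inord (y k)].
have hideE w i : hide_coordinate (val (f w)) i = ob (fun k => X w (bump i k)).
  by apply/ffunP => k; rewrite !ffunE.
rewrite exchange_big /=.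
apply: (@le_trans _ _ (\sum_(i < n) (\sum_w phi (ob (fun k => X w (bump 0 k))) i +
    e * #|Omega|%:R))).
  apply: ler_sum => i _; under eq_bigr => w _ do rewrite -/(f w) hideE.
  apply: (XF (fun y => phi (ob y) i)) => // [y|y y' yy].
    by rewrite /phi; do 2 case: (_ == i); rewrite ?subrr ?normr0 ?subr0 ?sub0r
      ?normrN ?normr1.
  by congr (phi _ i); apply/ffunP => k; rewrite !ffunE yy.
rewrite big_split /= sumr_const card_ord -[_ *+ n]mulr_natr exchange_big /= big1 ?add0r //.
move=> w _; have := sum_indicator (fun=> 1) (val g (ob (fun k => X w (bump 0 k)))).1
  (val g (ob (fun k => X w (bump 0 k)))).2.
by rewrite subrr => H; rewrite -[RHS]H; apply: eq_bigr => i _; rewrite mul1r.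
Qed.

End ValueBounds.

(** * Nearly deletion-invariant laws *)

Lemma count_ltn_modn (q d c : nat) : (\sum_(u < q * d) (u %% d < c) <= q * c)%N.
Proof.
have below m : (\sum_(0 <= u < m) (u < c) <= c)%N.
  suff -> : (\sum_(0 <= u < m) (u < c) = minn c m)%N by exact: geq_minl.
  elim: m => [|m IH]; first by rewrite big_geq // minn0.
  rewrite big_nat_recr //= IH; lia.
rewrite -(big_mkord xpredT (fun u => (u %% d < c)%N : nat)).
elim: q => [|q IH]; first by rewrite big_geq.
rewrite mulSnr (big_cat_nat (n := q * d)) //=; last exact: leq_addr.
rewrite mulSnr; apply: leq_add => //.
rewrite -{1}[(q * d)%N]add0n big_addn addKn; apply: leq_trans (below d).
rewrite !big_mkord; apply: leq_sum => u _.
by rewrite addnC modnMDl modn_small.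
Qed.

Section DealerDistributions.
Variable R : realType.
Implicit Types (F : (nat -> nat) -> R) (f : nat -> R).

(** Each unit shift exchanges one boundary term for another, at cost at most 2. *)
Lemma sum_shift_le f (m s : nat) : (forall a, `|f a| <= 1) ->
  \sum_(a < m) f a <= \sum_(a < m) f (a + s)%N + 2 * s%:R.
Proof.
move=> f1; have fle a : - 1 <= f a <= 1 by rewrite -ler_norml.
elim: s => [|s IH].
  by rewrite mulr0 addr0; under [leRHS]eq_bigr do rewrite addn0.
have E : \sum_(a < m) f (a + s.+1)%N = \sum_(a < m) f (a + s)%N + f (m + s)%N - f s.
  rewrite -(big_ord_recr m (fun a : 'I_m.+1 => f (a + s)%N)) big_ord_recl /=.
  by rewrite add0n addrAC subrr add0r; apply: eq_bigr => a _; rewrite addnS.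
rewrite E -natr1; have := fle (m + s)%N; have := fle s; lra.
Qed.

Lemma sum_shift_ge f (m s : nat) : (forall a, `|f a| <= 1) ->
  \sum_(a < m) f (a + s)%N <= \sum_(a < m) f a + 2 * s%:R.
Proof.
move=> f1; have := @sum_shift_le (fun a => - f a) m s.
rewrite !sumrN => H; have : forall a, `|- f a| <= 1 by move=> a; rewrite normrN.
by move/H; lra.
Qed.

(** The pair consists of consecutive numbers at a uniform place, so the two deletions are unit
    shifts of each other. *)
Lemma dealer_secures2 (m : nat) : @dealer_secures R 2 m.+2 (2 / m.+1%:R).
Proof.
exists 'I_m.+1, ord0, (fun (a : 'I_m.+1) j => (a.+1 + j)%N); split.
- by move=> w k _; lia.
- by move=> w [|[|k]] // _; have := ltn_ord w; lia.
move=> F F1 Fl; pose f a := F (fun=> a).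
have F0 y : F y = f (y 0%N) by apply: Fl => -[].
case=> [|[|i]] // _; first by rewrite lerDl mulr_ge0 // divr_ge0.
have := @sum_shift_le (fun a => f a.+1) m.+1 1 (fun a => F1 _).
rewrite card_ord mulfVK ?pnatr_eq0 // mulr1.
by congr (_ <= _ + _); apply: eq_bigr => a _; rewrite F0 /= ?addn0 ?addn1.
Qed.

(** The law is (a, a + 2^k, a + 2^(k+1)) with [a] and [k] uniform. Compared with deleting the last
    number, deleting the middle one shifts [k] by 1 and deleting the first shifts [a] by 2^k. Each
    costs 2 / m, the latter because the 2^k sum to less than 2^m. *)
Lemma dealer_secures3 (m N : nat) : (0 < m)%N -> (2 ^ m.+1 <= N)%N ->
  @dealer_secures R 3 N (4 / m%:R).
Proof.
move=> m0 mN; have m0' : 0 < m%:R :> R by rewrite ltr0n.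
have L0 : (0 < 2 ^ m)%N by rewrite expn_gt0.
exists ('I_m * 'I_(2 ^ m))%type, (Ordinal m0, Ordinal L0),
  (fun (w : 'I_m * 'I_(2 ^ m)) j => (w.2.+1 + (if j is j'.+1 then 2 ^ (w.1 + j') else 0))%N); split.
- move=> [k a] [|[|j]] // _ /=; rewrite ?addn0 ?addn1.
    by rewrite -[X in (X < _)%N]addn0 ltn_add2l expn_gt0.
  by rewrite ltn_add2l ltn_exp2l.
- move=> [k a] j j3 /=; apply: leq_trans mN; rewrite expnS mul2n -addnn.
  apply: leq_add => //; case: j j3 => // j j3.
  by rewrite leq_exp2l //; have := ltn_ord k; lia.
move=> F F1 Fl.
pose f a k := F (fun j => if j is 0%N then a else (a + 2 ^ k)%N).
have f1 a k : `|f a k| <= 1 by apply: F1.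
have F2 y a k : y 0%N = a -> y 1%N = (a + 2 ^ k)%N -> F y = f a k.
  by move=> y0 y1; apply: Fl => -[|[|j]].
have S0 : \sum_(w : 'I_m * 'I_(2 ^ m)) f w.2.+1 w.1 <=
    \sum_(w : 'I_m * 'I_(2 ^ m)) f (w.2.+1 + 2 ^ w.1)%N w.1 + 2 * (2 ^ m)%:R.
  rewrite -!(pair_bigA _ (fun (k : 'I_m) (a : 'I_(2 ^ m)) => f a.+1 k)).
  rewrite -(pair_bigA _ (fun (k : 'I_m) (a : 'I_(2 ^ m)) => f (a.+1 + 2 ^ k)%N k)).
  apply: (@le_trans _ _ (\sum_(k < m) (\sum_(a < 2 ^ m) f (a.+1 + 2 ^ k)%N k +
      2 * (2 ^ k)%:R))).
    by apply: ler_sum => k _; apply: (@sum_shift_le (fun a => f a.+1 k)).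
  rewrite big_split /= lerD2l -mulr_sumr ler_pM2l // -natr_sum ler_nat.
  rewrite -(big_mkord xpredT (fun k => 2 ^ k)%N).
  elim: (m) => [|l IH]; first by rewrite big_geq.
  by rewrite big_nat_recr //= expnS mul2n -addnn leq_add2r.
have S1 : \sum_(w : 'I_m * 'I_(2 ^ m)) f w.2.+1 w.1.+1 <=
    \sum_(w : 'I_m * 'I_(2 ^ m)) f w.2.+1 w.1 + 2 * (2 ^ m)%:R.
  rewrite -!(pair_bigA _ (fun (k : 'I_m) (a : 'I_(2 ^ m)) => f a.+1 k)).
  rewrite -(pair_bigA _ (fun (k : 'I_m) (a : 'I_(2 ^ m)) => f a.+1 k.+1)).
  rewrite exchange_big [X in _ <= X + _]exchange_big /=.
  have -> : 2 * (2 ^ m)%:R = \sum_(a < 2 ^ m) 2 :> R.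
    by rewrite sumr_const card_ord mulr_natr.
  rewrite -big_split; apply: ler_sum => a _ /=.
  have := @sum_shift_ge (fun k => f a.+1 k) m 1 (fun=> f1 _ _).
  by rewrite mulr1 /=; under eq_bigr do rewrite addn1.
have -> : 4 / m%:R * #|{: 'I_m * 'I_(2 ^ m)}|%:R = 4 * (2 ^ m)%:R :> R.
  by rewrite card_prod !card_ord natrM mulrA mulfVK ?gt_eqF.
have p0 : 0 <= (2 ^ m)%:R :> R by exact: ler0n.
case=> [|[|[|i]]] // _; first by rewrite lerDl mulr_ge0.
all: rewrite [X in _ <= X + _](_ : _ = \sum_(w : 'I_m * 'I_(2 ^ m))
  f (w.2.+1 + 2 ^ w.1)%N w.1); last first.
1,3: by apply: eq_bigr => -[k a] _; apply: F2; rewrite /bump /= ?addn0 ?addn1 //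
  expnS mul2n -addnn addnA.
  rewrite (_ : \sum_w _ = \sum_(w : 'I_m * 'I_(2 ^ m)) f w.2.+1 w.1.+1); first lra.
  by apply: eq_bigr => -[k a] _; apply: F2; rewrite /bump /= ?addn0 ?addn1.
rewrite (_ : \sum_w _ = \sum_(w : 'I_m * 'I_(2 ^ m)) f w.2.+1 w.1); first lra.
by apply: eq_bigr => -[k a] _; apply: F2; rewrite /bump /= ?addn0 ?addn1.
Qed.

(** Coordinates of a uniform function are uniform: the sum factors over coordinates, with test
    function 1 away from [t]. *)
Lemma sum_ffun_coord (I J : finType) (t : I) (g : J -> R) :
  #|J|%:R * \sum_(v : {ffun I -> J}) g (v t) =
  #|{: {ffun I -> J}}|%:R * \sum_u g u.
Proof.
pose G i u : R := if i == t then g u else 1.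
have -> : \sum_(v : {ffun I -> J}) g (v t) = \sum_(v : {ffun I -> J}) \prod_i G i (v i).
  apply: eq_bigr => v _; rewrite (bigD1 t) //= /G eqxx big1 ?mulr1 // => i.
  by move=> /negPf ->.
have cardE : #|{: {ffun I -> J}}|%:R = \prod_(i : I) #|J|%:R :> R.
  by rewrite prodr_const card_ffun natrX.
rewrite -(bigA_distr_bigA G) cardE (bigD1 t) //= [in RHS](bigD1 t) //= {1}/G eqxx.
rewrite [RHS]mulrAC mulrA; congr (_ * _ * _).
by apply: eq_bigr => i /negPf it; rewrite /G it sumr_const.
Qed.

(** * Adding a coordinate to a Dealer law *)

Section Step.
Variables (M B : nat).
Hypothesis B2 : (2 <= B)%N.

(** One modulus divisible by every [B ^ t] with [t <= M]: reductions of uniform noise stay uniform,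
    and translations modulo it are bijective. *)
Local Notation P := (B ^ M.+1)%N.
Local Notation noise := {ffun 'I_M.+1 -> 'I_P}.
Implicit Type v : noise.

(* The increment attached to the value t; making the noise a function of t rather
   than of the position makes it insensitive to the deletion of coordinates. *)
Definition jump v (t : nat) : nat := (B ^ t + v (inord t) %% B ^ t)%N.

Let Bt0 t : (0 < B ^ t)%N. Proof. by rewrite expn_gt0 ltnW. Qed.

Lemma jump_ge v t : (B ^ t <= jump v t)%N.
Proof. exact: leq_addr. Qed.

Lemma jump_lt v t : (jump v t < 2 * B ^ t)%N.
Proof. by rewrite mul2n -addnn ltn_add2l ltn_mod Bt0. Qed.

Lemma jump_lt_exp v t t' : (t < t')%N -> (jump v t < B ^ t')%N.
Proof.
move=> tt; apply: leq_trans (jump_lt v t) _.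
apply: (@leq_trans (B ^ t.+1)); first by rewrite expnS leq_mul2r B2 orbT.
by rewrite leq_exp2l.
Qed.

(* Replaces the increments measured from a by those measured from a + jump v s. *)
Definition shift_noise (s : nat) v : noise :=
  [ffun t => if t == inord s then v t
             else Ordinal (ltn_pmod (v t + (P - jump v s)) (Bt0 M.+1))].

(** [jump v s] depends only on the coordinate at [s], which is kept, so the translation can be
    undone. *)
Lemma shift_noise_inj s : injective (shift_noise s).
Proof.
move=> v v' /ffunP e; have es : v (inord s) = v' (inord s).
  by have := e (inord s); rewrite !ffunE eqxx.
apply/ffunP => t; have := e t; rewrite !ffunE; case: eqP => // _.
have -> : jump v s = jump v' s by rewrite /jump es.
move/(congr1 val) => /= /eqP; rewrite eqn_modDr !modn_small // => /eqP.
exact: val_inj.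
Qed.

Lemma jump_shift_same s v : jump (shift_noise s v) s = jump v s.
Proof. by rewrite /jump ffunE eqxx. Qed.

(** As [B ^ t] divides the modulus, the translation acts on residues modulo [B ^ t]; the last
    hypothesis excludes wrapping around. *)
Lemma jump_shift_noise s t v : (s < t)%N -> (t <= M)%N ->
  (jump v s <= v (inord t) %% B ^ t)%N ->
  (jump v s + jump (shift_noise s v) t)%N = jump v t.
Proof.
move=> st tM le; rewrite {2 3}/jump ffunE ifF /=; last first.
  by apply/eqP => /(congr1 val); rewrite /= !inordK; lia.
rewrite modn_dvdm; last by rewrite dvdn_exp2l // ltnW.
have jP : (jump v s <= P)%N by apply/ltnW/jump_lt_exp; lia.
have d : (B ^ t %| P)%N by rewrite dvdn_exp2l // ltnW.
rewrite addnCA; congr (_ + _)%N.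
have jv : (jump v s <= v (inord t))%N by apply: leq_trans le (leq_mod _ _).
rewrite addnBA // -addnBAC // -modnDmr (eqP d) addn0.
rewrite {1}(divn_eq (v (inord t)) (B ^ t)) -addnBA //.
rewrite modnMDl modn_small ?subnKC //.
by apply: leq_ltn_trans (leq_subr _ _) _; rewrite ltn_mod.
Qed.

(** A uniform residue modulo [B ^ t] is below [2 * B ^ s] with probability at most 2 / B, since
    [s < t]. Bounding [jump v s] by [2 * B ^ s] makes the event depend on one coordinate. *)
Lemma count_bad_noise s t : (s < t)%N -> (t <= M)%N ->
  \sum_(v : noise) (v (inord t) %% B ^ t < 2 * B ^ s)%N%:R <=
  2 / B%:R * #|{: noise}|%:R :> R.
Proof.
move=> st tM; have B0 : 0 < B%:R :> R by rewrite ltr0n ltnW.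
have P0 : 0 < P%:R :> R by rewrite ltr0n.
rewrite -(ler_pM2l P0) -{1}[P]card_ord.
rewrite (sum_ffun_coord (inord t) (fun u : 'I_P => (u %% B ^ t < 2 * B ^ s)%N%:R)).
rewrite mulrC mulrA ler_wpM2r // mulrA ler_pdivlMr // -natr_sum -!natrM ler_nat.
have PE : P = (B ^ (M.+1 - t) * B ^ t)%N by rewrite -expnD subnK // ltnW.
apply: (@leq_trans (B ^ (M.+1 - t) * (2 * B ^ s) * B)).
  have := count_ltn_modn (B ^ (M.+1 - t)) (B ^ t) (2 * B ^ s).
  by rewrite -PE leq_mul2r => ->; rewrite orbT.
rewrite [in leqRHS]PE -!mulnA -expnSr (mulnC (B ^ t)%N).
rewrite !leq_mul2l leq_exp2l //.
by rewrite st !orbT.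
Qed.

(** Reindexing by [shift_noise] turns the left tuple into the right one unless some residue is bad.
    A bad noise costs 2, and there are [p] bad events of probability at most 2 / B. *)
Lemma shift_noise_close F s (t : nat -> nat) (p a : nat) :
  (forall y, `|F y| <= 1) ->
  (forall y y', (forall k, (k < p.+1)%N -> y k = y' k) -> F y = F y') ->
  (forall j, (j < p)%N -> (s < t j <= M)%N) ->
  \sum_v F (fun j => (a + jump v s + if j is i.+1 then jump v (t i) else 0)%N) <=
  \sum_v F (fun j => (a + if j is i.+1 then jump v (t i) else jump v s)%N) +
  4 * p%:R / B%:R * #|{: noise}|%:R.
Proof.
move=> F1 Fl st.
pose bad v j : R := (v (inord (t j)) %% B ^ t j < 2 * B ^ s)%N%:R.
have -> : 4 * p%:R / B%:R * #|{: noise}|%:R =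
    2 * \sum_(j < p) (2 / B%:R * #|{: noise}|%:R) :> R.
  by rewrite sumr_const card_ord -[_ *+ p]mulr_natr; ring.
apply: (@le_trans _ _ (\sum_v F (fun j =>
    (a + if j is i.+1 then jump v (t i) else jump v s)%N) +
    2 * \sum_(j < p) \sum_v bad v j)); last first.
  rewrite lerD2l ler_pM2l //; apply: ler_sum => j _.
  by have /andP[sj tj] := st j (ltn_ord j); exact: count_bad_noise.
rewrite (reindex_inj (@shift_noise_inj s)) exchange_big /= mulr_sumr -big_split /=.
apply: ler_sum => v _; rewrite jump_shift_same.
have bad0 j : 0 <= bad v j by exact: ler0n.
have [/existsP[j jbad]|/existsPn good] :=
    boolP [exists j : 'I_p, (v (inord (t j)) %% B ^ t j < jump v s)%N].
  have : 1 <= \sum_(j < p) bad v j.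
    rewrite (bigD1 j) //= {1}/bad (ltn_trans jbad (jump_lt _ _)) lerDl.
    by apply: sumr_ge0.
  have /andP[_ ] : -1 <= F (fun j => (a + jump v s +
      if j is i.+1 then jump (shift_noise s v) (t i) else 0)%N) <= 1.
    by rewrite -ler_norml.
  have /andP[] : -1 <= F (fun j =>
      (a + if j is i.+1 then jump v (t i) else jump v s)%N) <= 1.
    by rewrite -ler_norml.
  lra.
have sum0 : 0 <= \sum_(j < p) bad v j by apply: sumr_ge0.
rewrite [leLHS](_ : _ = F (fun j =>
    (a + if j is i.+1 then jump v (t i) else jump v s)%N)); first lra.
apply: Fl => -[_|j jp]; first by rewrite addn0.
have /andP[sj tj] := st j jp; rewrite -addnA jump_shift_noise //.
by have := good (Ordinal (jp : (j < p)%N)); rewrite -leqNgt.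
Qed.

(** Deletions other than the first delete from the inner law and agree up to [e]. Passing from
    deleting coordinate 1 to deleting coordinate 0 costs 2 / B for translating [a] and 4 (p+1) / B
    for the noise. *)
Lemma dealer_secures_step (p N : nat) (e : R) : (B ^ M.+3 <= N)%N ->
  @dealer_secures R p.+2 M e ->
  @dealer_secures R p.+3 N (e + 4 * p.+2%:R / B%:R).
Proof.
move=> BN [Omega [w0 [X [Xi XM XF]]]].
have B0 : 0 < B%:R :> R by rewrite ltr0n ltnW.
have P0 : 0 < P%:R :> R by rewrite ltr0n.
(* Translations of [a] are by less than [P], so this range makes their relative cost 2 / B. *)
pose L := (B * P)%N; have L0 : (0 < L)%N by rewrite muln_gt0 (ltnW B2) Bt0.
pose Omega' := (Omega * ('I_L * noise))%type.
pose Y (w : Omega') (j : nat) : nat :=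
  (w.2.1.+1 + if j is i.+1 then jump w.2.2 (X w.1 i) else 0)%N.
exists Omega', (w0, (Ordinal L0, [ffun=> Ordinal (Bt0 M.+1)])), Y; split.
- move=> [w [a v]] [|j] jp; rewrite /Y /= ltn_add2l.
    exact: leq_trans (Bt0 _) (jump_ge _ _).
  by apply: leq_trans (jump_ge _ _); apply: jump_lt_exp; apply: Xi.
(* [a.+1] and the jump are each at most [L = B ^ M.+2], and [2 <= B]. *)
- move=> [w [a v]] j jp; rewrite /Y /=; apply: leq_trans BN.
  apply: (@leq_trans (L + L)).
    apply: leq_add => //; case: j jp => // j jp.
    apply: (@leq_trans P); last by rewrite leq_pmull // ltnW.
    by apply/ltnW/jump_lt_exp; have /andP[] := XM w j jp.
  by rewrite addnn -mul2n /L [leqRHS]expnS [(B ^ M.+2)%N]expnS leq_mul2r B2 orbT.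
move=> F F1 Fl i ip.
have cardO : #|{: Omega'}|%:R = #|Omega|%:R * (L%:R * #|{: noise}|%:R) :> R.
  by rewrite !card_prod card_ord !natrM.
have split_sum (G : Omega -> 'I_L -> noise -> R) :
    \sum_(w : Omega') G w.1 w.2.1 w.2.2 = \sum_w \sum_a \sum_v G w a v.
  under [RHS]eq_bigr do rewrite pair_bigA; rewrite pair_bigA.
  by apply: eq_bigr => -[w [a v]].
pose Phi a v (y : nat -> nat) (j : nat) : nat :=
  (a.+1 + if j is i.+1 then jump v (y i) else 0)%N.
have inner k : (k < p.+2)%N -> \sum_w F (fun j => Y w (bump k.+1 j)) =
    \sum_(a < L) \sum_v \sum_w F (Phi a v (fun j => X w (bump k j))).
  move=> kp; rewrite (split_sum (fun w a v => F (fun j => Y (w, (a, v)) (bump k.+1 j)))).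
  rewrite exchange_big; apply: eq_bigr => a _; rewrite exchange_big /=.
  apply: eq_bigr => v _; apply: eq_bigr => w _; apply: Fl => -[|j] _ //.
  by rewrite /Y /Phi /bump /= addnS.
pose E : R := #|Omega|%:R * (L%:R * #|{: noise}|%:R).
have E0 : 0 <= E by rewrite !mulr_ge0.
have base : \sum_w F (fun j => Y w (bump 1 j)) <= \sum_w F (fun j => Y w (bump 0 j)) +
    4 * p.+2%:R / B%:R * E.
  rewrite (inner 0%N) // (split_sum (fun w a v => F (fun j => Y (w, (a, v)) (bump 0 j)))).
  under eq_bigr do rewrite exchange_big; rewrite exchange_big /=.
  have -> : 4 * p.+2%:R / B%:R * E =
      \sum_(w : Omega) (4 * p.+2%:R / B%:R * (L%:R * #|{: noise}|%:R)).
    by rewrite sumr_const -[_ *+ _]mulr_natr /E; ring.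
  rewrite -big_split; apply: ler_sum => w _ /=.
  have sw k : (k < p.+1)%N -> (X w 0 < X w k.+1 <= M)%N.
    move=> kp; have /andP[_ ->] := XM w k.+1 kp; rewrite andbT.
    elim: k kp => [|k IH] kp; first exact: Xi.
    by apply: ltn_trans (IH (ltnW kp)) _; apply: Xi.
  set s := X w 0 in sw *; pose t k := X w k.+1.
  apply: (@le_trans _ _ (\sum_v (\sum_(a < L) F (Phi (a + jump v s)%N v t) + 2 * P%:R))).
    rewrite exchange_big /=; apply: ler_sum => v _.
    apply: (@le_trans _ _ (\sum_(a < L) F (Phi (a + jump v s)%N v t) + 2 * (jump v s)%:R)).
      exact: (@sum_shift_le (fun a => F (Phi a v t))).
    rewrite lerD2l ler_pM2l // ler_nat ltnW //; apply: jump_lt_exp.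
    by have /andP[] := XM w 0%N isT.
  rewrite big_split exchange_big /=.
  have -> : \sum_(v : noise) 2 * P%:R = 2 * P%:R * #|{: noise}|%:R :> R.
    by rewrite sumr_const [RHS]mulr_natr.
  have -> : 4 * p.+2%:R / B%:R * (L%:R * #|{: noise}|%:R) =
      \sum_(a < L) (4 * p.+1%:R / B%:R * #|{: noise}|%:R) +
      4 * P%:R * #|{: noise}|%:R :> R.
    rewrite sumr_const card_ord -[_ *+ L]mulr_natr /L natrM -[p.+2%:R]natr1.
    by field; rewrite gt_eqF.
  rewrite addrA -big_split /=; apply: lerD; last first.
    by rewrite ler_wpM2r // ler_wpM2r //; lra.
  apply: ler_sum => a _.
  have := @shift_noise_close F s t p.+1 a.+1 F1 Fl sw.
  congr (_ <= _ + _); apply: eq_bigr => v _; apply: Fl => -[|j] _;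
    rewrite /Phi /Y ?addSn //.
(* Obtained by testing with the zero function. *)
have e0 : 0 <= e.
  have := XF (fun=> 0) ltac:(by move=> y; rewrite normr0) ltac:(by []) 0%N isT.
  rewrite lerDl pmulr_lge0 // ltr0n; apply/card_gt0P; by exists w0.
have q0 : 0 <= 4 * p.+2%:R / B%:R :> R by rewrite divr_ge0 // mulr_ge0.
rewrite cardO -/E mulrDl.
case: i ip => [|i] ip; first by rewrite lerDl addr_ge0 // mulr_ge0.
apply: (@le_trans _ _ (\sum_w F (fun j => Y w (bump 1 j)) + e * E)); last lra.
rewrite !inner //.
have -> : e * E = \sum_(a < L) \sum_(v : noise) (e * #|Omega|%:R).
  by rewrite !sumr_const card_ord -!mulrnA -[_ *+ _]mulr_natr natrM /E; ring.
rewrite -big_split; apply: ler_sum => a _; rewrite -big_split; apply: ler_sum => v _.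
apply: (XF (fun y => F (Phi a v y))) => // y y' yy.
by apply: Fl => -[|j] // jp; rewrite /Phi yy.
Qed.

End Step.
End DealerDistributions.

(** * Asymptotics *)

Section IteratedLogarithm.
Variable R : realType.
Implicit Types x y t u : R.
Local Notation log := (@log2 R).

Let ln2_gt0 : 0 < ln 2 :> R. Proof. by rewrite ln_gt0 // ltr1n. Qed.

Lemma ler_log2 x y : 0 < x -> x <= y -> log x <= log y.
Proof.
move=> x0 xy; rewrite /log2 ler_pM2r ?invr_gt0 // ler_ln // posrE //.
exact: lt_le_trans xy.
Qed.

Lemma log2M x y : 0 < x -> 0 < y -> log (x * y) = log x + log y.
Proof. by move=> x0 y0; rewrite /log2 lnM ?posrE // mulrDl. Qed.

Lemma log2_expn (k : nat) : log (2 ^ k)%:R = k%:R.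
Proof. by rewrite natrX /log2 lnXn // -[ln 2 *+ k]mulr_natl mulfK // gt_eqF. Qed.

Lemma log2_le_double x : 0 < x -> log x <= 2 * x.
Proof.
move=> x0; have h : 1 / 2 <= ln 2 :> R.
  have : ln (1 + - (1 / 2)) <= - (1 / 2) :> R by apply: le_ln1Dx; lra.
  have -> : 1 + - (1 / 2) = 2^-1 :> R by field.
  by rewrite lnV ?posrE //; lra.
rewrite /log2 ler_pdivrMr //; have := ln_sublinear x0; nra.
Qed.

Lemma iter_log2_ge (k A : nat) :
  exists T : nat, forall x, T%:R <= x -> A%:R <= iter k log x.
Proof.
elim: k A => [|k IH] A; first by exists A.
have [T hT] := IH (2 ^ A)%N; exists T => x /hT h.
by rewrite iterS -log2_expn ler_log2 // ltr0n expn_gt0.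
Qed.

(** Lets the 1 / M error of Dealer's step be absorbed into a reciprocal iterated logarithm. *)
Lemma iter_log2_le (k : nat) :
  exists T : nat, forall x, T%:R <= x -> iter k log x <= 2 ^+ k * x.
Proof.
elim: k => [|k [T1 IH]]; first by exists 0%N => x _; rewrite mul1r.
have [T2 h2] := iter_log2_ge k 1.
exists (maxn T1 T2) => x; rewrite natr_max ge_max => /andP[/IH le1 /h2 ge1].
rewrite iterS exprS -mulrA; apply: le_trans (log2_le_double _) _; first lra.
by rewrite ler_pM2l.
Qed.

(** The factor 4 reproduces itself: log (4 b) = 2 + log b <= 4 log b once b >= 2. *)
Lemma iter_log2_compare (k : nat) : exists T : nat, forall t u,
  T%:R <= t -> T%:R <= u -> t <= 4 * u -> iter k log t <= 4 * iter k log u.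
Proof.
elim: k => [|k [T1 IH]]; first by exists 0%N.
have [T2 h2] := iter_log2_ge k 2.
exists (maxn T1 T2) => t u; rewrite natr_max !ge_max.
move=> /andP[t1 /h2 t2] /andP[u1 /h2 u2] tu.
have := IH t u t1 u1 tu; rewrite !iterS.
move: (iter k _ t) (iter k _ u) t2 u2 => a b a2 b2 ab.
have b0 : 0 < b by lra.
have : log 2%:R <= log b by apply: ler_log2.
rewrite -[2%N]expn1 log2_expn => lb.
have : log a <= log ((2 ^ 2)%:R * b) by apply: ler_log2 => //; lra.
rewrite log2M // log2_expn; lra.
Qed.

Lemma trunc_log_log2 (N : nat) : (0 < N)%N ->
  (trunc_log 2 N)%:R <= log N%:R <= (trunc_log 2 N).+1%:R.
Proof.
move=> N0; rewrite -(log2_expn (trunc_log 2 N)) -(log2_expn (trunc_log 2 N).+1).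
apply/andP; split; apply: ler_log2; rewrite ?ltr0n ?expn_gt0 // ler_nat.
  exact: trunc_logP.
by rewrite ltnW // trunc_log_ltn.
Qed.

Lemma gambler_secures_le (n N : nat) (c d : R) :
  d <= c -> gambler_secures n N c -> gambler_secures n N d.
Proof.
move=> dc [g [g0 g1 gl gc]]; exists g; split=> // x xi xN.
exact: le_trans dc (gc x xi xN).
Qed.

Lemma dealer_secures_le (n N : nat) (e d : R) :
  e <= d -> dealer_secures n N e -> dealer_secures n N d.
Proof.
move=> ed [Omega [w0 [X [Xi XN XF]]]]; exists Omega, w0, X; split=> // F F1 Fl i ip.
by apply: le_trans (XF F F1 Fl i ip) _; rewrite lerD2l ler_wpM2r.
Qed.

Lemma gambler_asymptotics (p : nat) : exists2 c : R, 0 < c & exists N0 : nat,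
  forall N : nat, (N0 <= N)%N -> gambler_secures p.+2 N (c / iter p log N%:R).
Proof.
case: p => [|p].
  by exists 1 => //; exists 1%N => N N1; rewrite div1r; apply: gambler_secures2.
have half N : (2 <= N)%N -> (trunc_log 2 N).+1%:R <= 2 * log N%:R.
  move=> N2; have /andP[h _] := trunc_log_log2 (ltnW N2).
  have : 1 <= (trunc_log 2 N)%:R :> R by rewrite ler1n trunc_log_gt0.
  by rewrite -natr1; lra.
elim: p => [|p [c c0 [N0 IH]]].
  exists (1 / 4); first lra.
  exists 2%N => N N2; have h := half N N2.
  have M0 : 0 < (trunc_log 2 N).+1%:R :> R by rewrite ltr0n.
  apply: (gambler_secures_le _ (@gambler_secures3 _ N (trunc_log 2 N).+1 _ _)) => //.
    rewrite /= div1r -invfM lef_pV2 ?posrE; lra.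
  exact: trunc_log_ltn.
have [T1 h1] := iter_log2_compare p.+1.
have [T2 h2] := iter_log2_ge p.+1 1.
have [T3 h3] := iter_log2_ge p.+1 (Num.bound c).
pose K : R := 2 * p.+4%:R * (3 * p.+1%:R + 1).
have K0 : 0 < K by rewrite /K !mulr_gt0 // ltr_pwDr // mulr_ge0.
pose T := maxn 2 (maxn N0 (maxn T1 (maxn T2 T3))).
have [T2T N0T T1T T2T' T3T] :
    [/\ 2 <= T, N0 <= T, T1 <= T, T2 <= T & T3 <= T]%N.
  by rewrite /T !leq_max !leqnn !orbT.
(* The 4 comes from [iter_log2_compare] and [K] is the loss of one step; [T3] makes the inductive
   bound at most 1, as the step requires. *)
exists (c / (4 * K)); first by rewrite divr_gt0 // mulr_gt0.
exists (2 ^ T)%N => N NT.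
have T2N : (2 <= 2 ^ T)%N by rewrite -[2%N in leqLHS]expn1 leq_exp2l // ltnW.
have N2 : (2 <= N)%N := leq_trans T2N NT.
set M := (trunc_log 2 N).+1.
have lT : (T <= trunc_log 2 N)%N by apply: trunc_log_max.
have lTR : T%:R <= (trunc_log 2 N)%:R :> R by rewrite ler_nat.
have /andP[l1 _] := trunc_log_log2 (ltnW N2).
have TM : T%:R <= M%:R :> R by rewrite ler_nat leqW.
have Ti (T' : nat) x : (T' <= T)%N -> T%:R <= x -> T'%:R <= x.
  by move=> tt; apply: le_trans; rewrite ler_nat.
have m1 : 1 <= iter p.+1 log M%:R by apply: h2; exact: Ti TM.
have m2 : c <= iter p.+1 log M%:R.
  apply: le_trans (ltW (archi_boundP (ltW c0))) _.
  by apply: h3; exact: Ti TM.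
have cmp : iter p.+1 log M%:R <= 4 * iter p.+1 log (log N%:R).
  apply: h1; first exact: Ti TM.
    by apply: Ti T1T _; lra.
  by have := half N N2; have : 0 <= (trunc_log 2 N)%:R :> R by []; rewrite -/M; lra.
rewrite (iterSr p.+1); move: cmp m1 m2; set a := iter _ _ M%:R; set b := iter _ _ _.
move=> ab a1 ac; have a0 : 0 < a by lra.
have b0 : 0 < b by lra.
apply: (gambler_secures_le _ (@gambler_secures_step _ p N M (c / a) _ _ _)).
- rewrite -/K -[c / (4 * K) / b]mulrA -[c / a / K]mulrA -!invfM ler_pM2l //.
  have Kb : 0 < 4 * K * b by apply: mulr_gt0 b0; lra.
  by rewrite lef_pV2 ?posrE //; [have := ler_wpM2r (ltW K0) ab; lra|exact: mulr_gt0].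
- by rewrite (divr_ge0 (ltW c0) (ltW a0)) (ler_pdivrMr _ _ a0) mul1r.
- exact: trunc_log_ltn.
- by apply: IH; apply: leq_trans (leqW lT).
Qed.

Lemma dealer_asymptotics (p : nat) : exists2 C : R, 0 < C & exists N0 : nat,
  forall N : nat, (N0 <= N)%N -> dealer_secures p.+2 N (C / iter p log N%:R).
Proof.
case: p => [|p].
  exists 4 => //; exists 2%N => -[|[|m]] // _.
  apply: (dealer_secures_le _ (dealer_secures2 R m)).
  rewrite /= ler_pdivrMr ?ltr0n // mulrAC ler_pdivlMr ?ltr0n //.
  by rewrite -!natrM ler_nat; lia.
elim: p => [|p [C C0 [N0 IH]]].
  (* With [m] one less than the truncated logarithm, log N <= m + 2 <= 2 m, so 4 / m <= 8 / log
     N. *)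
  exists 8 => //; exists (2 ^ 4)%N => N N4.
  have N0 : (0 < N)%N by apply: leq_trans N4; rewrite expn_gt0.
  have l4 : (4 <= trunc_log 2 N)%N by apply: trunc_log_max.
  have /andP[hl hu] := trunc_log_log2 N0; have := trunc_logP (ltnSn 1) N0.
  move: hl hu l4; case: (trunc_log 2 N) => // m hl hu m3 mN.
  have m3' : 3 <= m%:R :> R by rewrite ler_nat.
  apply: (dealer_secures_le _ (@dealer_secures3 R m N _ _)) => //; last lia.
  rewrite -!natr1 in hl hu; rewrite /= ler_pdivrMr; last lra.
  by rewrite mulrAC ler_pdivlMr; lra.
have [T1 h1] := iter_log2_compare p.
have [T2 h2] := iter_log2_ge p 1.
have [T3 h3] := iter_log2_le p.+1.
(* The inductive constant plus the step's error 4 (p+3) / M, bounded by [iter_log2_le]. *)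
pose D : R := C + 4 * p.+3%:R * 2 ^+ p.+1.
have D0 : 0 < D by apply: ltr_wpDr => //; rewrite !mulr_ge0 ?exprn_ge0.
pose T := maxn 2 (maxn N0 (maxn T1 (maxn T2 T3))).
have [T2T N0T T1T T2T' T3T] :
    [/\ 2 <= T, N0 <= T, T1 <= T, T2 <= T & T3 <= T]%N.
  by rewrite /T !leq_max !leqnn !orbT.
have D4 : 0 < 4 * D by lra.
exists (4 * D) => //.
exists (2 ^ 4 ^ T)%N => N NT.
have N0' : (0 < N)%N by apply: leq_trans NT; rewrite expn_gt0.
have lT : (4 ^ T <= trunc_log 2 N)%N by apply: trunc_log_max.
set l := trunc_log 2 N in lT *.
have l0 : (0 < l)%N by apply: leq_trans lT; rewrite expn_gt0.
(* [M = 2 ^ s] is of the order of the square root of log N, so that the choice [B = M] fits: s (M +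
   3) <= M^2 <= l. One more logarithm turns the square root into a constant factor. *)
set s := trunc_log 4 l.
have sT : (T <= s)%N by apply: trunc_log_max.
have sl : (4 ^ s <= l)%N by apply: trunc_logP.
have ls : (l.+1 <= 4 ^ s.+1)%N by apply: trunc_log_ltn.
pose M := (2 ^ s)%N.
have sM : (s < M)%N by apply: ltn_expl.
have s2 : (2 <= s)%N := leq_trans T2T sT.
have MN : (M ^ M.+3 <= N)%N.
  apply: leq_trans (trunc_logP (ltnSn 1) N0'); rewrite -/l -expnM leq_exp2l //.
  apply: leq_trans sl; rewrite (_ : 4 ^ s = M * M)%N; last first.
    by rewrite /M -expnD addnn -mul2n expnM.
  have : (2 * s <= M)%N.
    rewrite /M; case: (s) s2 => // r _; rewrite expnS leq_mul2l /=; exact: ltn_expl.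
  nia.
have Ti (T' : nat) x : (T' <= T)%N -> T%:R <= x -> T'%:R <= x.
  by move=> tt; apply: le_trans; rewrite ler_nat.
have TsR : T%:R <= s%:R :> R by rewrite ler_nat.
have TMR : T%:R <= M%:R :> R by rewrite ler_nat; apply: leq_trans sT (ltnW sM).
have logM : log M%:R = s%:R by apply: log2_expn.
have /andP[lN1 lN2] := trunc_log_log2 N0'; rewrite -/l in lN1 lN2.
have loglogN : log (log N%:R) <= 4 * s%:R.
  apply: (@le_trans _ _ (log (2 ^ (2 * s.+1))%:R)).
    apply: ler_log2; first by apply: lt_le_trans lN1; rewrite ltr0n.
    by apply: le_trans lN2 _; rewrite ler_nat expnM.
  by rewrite log2_expn -natrM ler_nat; clear -s2; lia.
have loglogN' : s%:R <= log (log N%:R).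
  apply: (@le_trans _ _ (log (2 ^ (2 * s))%:R)); first by rewrite log2_expn ler_nat leq_pmull.
  apply: ler_log2; first by rewrite ltr0n expn_gt0.
  by apply: le_trans lN1; rewrite ler_nat expnM.
have cmp : iter p.+2 log N%:R <= 4 * iter p.+1 log M%:R.
  rewrite 3!iterSr logM; by apply: h1 => //; apply: Ti T1T _ => //; lra.
have b1 : 1 <= iter p.+2 log N%:R.
  by rewrite 2!iterSr; apply: h2; apply: (Ti _ _ T2T'); lra.
have a1 : 1 <= iter p.+1 log M%:R.
  by rewrite iterSr logM; apply: h2; exact: Ti TsR.
have aM : iter p.+1 log M%:R <= 2 ^+ p.+1 * M%:R.
  by apply: h3; exact: Ti TMR.
have N0M : (N0 <= M)%N := leq_trans N0T (leq_trans sT (ltnW sM)).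
have M2 : (2 <= M)%N := leq_trans s2 (ltnW sM).
apply: (dealer_secures_le _ (dealer_secures_step M2 MN (IH M N0M))).
move: cmp b1 a1 aM; set a := iter _ _ M%:R; set b := iter _ _ N%:R => ab b1 a1 aM.
have a0 : 0 < a by lra. have b0 : 0 < b by lra.
have M0 : 0 < M%:R :> R by rewrite ltr0n ltnW.
apply: (@le_trans _ _ (D / a)).
  rewrite /D [leRHS]mulrDl lerD2l -[leLHS]mulrA -[leRHS]mulrA -[leRHS]mulrA.
  by rewrite !ler_pM2l ?ltr0n // ler_pdivlMr // mulrC ler_pdivrMr.
by rewrite ler_pdivrMr // mulrAC ler_pdivlMr //; nra.
Qed.

End IteratedLogarithm.

Theorem corollary28 (R : realType) (n : nat) (hn : (2 <= n)%N) :
  exists (c C : R) (N0 : nat),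
    [/\ 0 < c, 0 < C &
        forall N : nat, (n <= N)%N -> (N0 <= N)%N ->
          c / iter (n - 2)%N (@log2 R) N%:R <= v1 R n N
            <= C / iter (n - 2)%N (@log2 R) N%:R].
Proof.
case: n hn => [|[|p]] // _; rewrite subn2 /=.
have [c c0 [N1 lower]] := gambler_asymptotics R p.
have [C C0 [N2 upper]] := dealer_asymptotics R p.
(* Passing from bets to the value costs n^2; passing from laws to the value costs nothing. *)
exists (c / p.+2%:R ^+ 2), C, (maxn N1 N2); split=> // [|N pN].
  by rewrite divr_gt0 // exprn_gt0 // ltr0n.
rewrite geq_max => /andP[/lower lowN /upper upN].
rewrite (v1_le _ upN) // andbT; apply: le_trans (le_v1 _ lowN) => //.
by rewrite mulrAC.
Qed.
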